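(* Let $e\in\mathbb{S}^{N-1}$. In the scalar setting on $\Omega=\mathbb{R}^N$ described in the context, assume that $A$ and $q$ depend only on $t$, that the functions $p^\pm=p^\pm(t,x\cdot e)$ depend only on $t$ and $x\cdot e$ and are nonincreasing in $x\cdot e$, that $f=f(t,x\cdot e,u)$ is nonincreasing in $x\cdot e$, that there is $\delta>0$ such that, for all $(t,x)\in\mathbb{R}\times\mathbb{R}^N$, $s\mapsto f(t,x\cdot e,s)$ is nonincreasing in $(-\infty,p^-(t,x\cdot e)+\delta]$ and in $[p^+(t,x\cdot e)-\delta,+\infty)$, and that $\inf\{p^+(t,x\cdot e)-p^-(t,x\cdot e);\ (t,x)\in\mathbb{R}\times\mathbb{R}^N\}>0$. If $u$ is a globally bounded transition wave connecting $p^-$ and $p^+$ for (E) which is almost planar in the direction $e$ with $$\Omega^\pm_t=\{x\in\mathbb{R}^N;\ \pm(x\cdot e-\xi_t)<0\}$$ for real numbers $\xi_t$ ($t\in\mathbb{R}$) such that $$\exists\,\sigma>0,\quad\sup\{|\xi_t-\xi_s|;\ (t,s)\in\mathbb{R}^2,\ |t-s|\le\sigma\}<+\infty,$$ then $u$ is planar, i.e. $u$ only depends on $t$ and $x\cdot e$: $$u(t,x)=\phi(t,x\cdot e)$$ for some function $\phi:\mathbb{R}^2\to\mathbb{R}$. Furthermore, $$p^-(t,x\cdot e)<u(t,x)<p^+(t,x\cdot e)\quad\text{for all }(t,x)\in\mathbb{R}\times\mathbb{R}^N,$$ and $u$ is decreasing with respect to $x\cdot e$.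
   Context: ''Decreasing'' is meant in the strict sense. $N\ge1$. Equation (E) (scalar, on $\mathbb{R}^N$): $$u_t=\nabla_x\cdot(A\nabla_xu)+q\cdot\nabla_xu+f(t,x,u),\qquad (t,x)\in\mathbb{R}\times\mathbb{R}^N,$$ where, for some $\beta>0$: $A=(a_{ij})$ is a matrix field of class $C^{1,\beta}$ on $\mathbb{R}\times\mathbb{R}^N$ with $\alpha_1|\xi|^2\le\sum_{i,j}a_{ij}\xi_i\xi_j\le\alpha_2|\xi|^2$ for some constants $0<\alpha_1\le\alpha_2$, at every $(t,x)$ and for all $\xi\in\mathbb{R}^N$; $q$ is an $\mathbb{R}^N$-valued vector field of class $C^{0,\beta}$ on $\mathbb{R}\times\mathbb{R}^N$; $f:\mathbb{R}\times\mathbb{R}^N\times\mathbb{R}\to\mathbb{R}$ is $C^{0,\beta}$ in $(t,x)$ locally in $u$, and locally Lipschitz-continuous in $u$ uniformly with respect to $(t,x)$. The functions $p^\pm$ are globally bounded classical solutions of (E). Transition wave. With $\Omega=\mathbb{R}^N$ and the sets $\Omega^\pm_t=\{x\in\mathbb{R}^N;\ \pm(x\cdot e-\xi_t)<0\}$, $\Gamma_t=\{x\in\mathbb{R}^N;\ x\cdot e=\xi_t\}$, the paper's general definition of a transition wave connecting $p^-$ and $p^+$ (almost planar in the direction $e$) amounts to the following: $u$ is a time-global (defined for all $t\in\mathbb{R}$) classical solution of (E), $u\not\equiv p^\pm$, and for every $\varepsilon>0$ there is $M\ge0$ such that for all $(t,x)\in\mathbb{R}\times\mathbb{R}^N$: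 $x\cdot e-\xi_t\le-M$ implies $|u(t,x)-p^+(t,x\cdot e)|\le\varepsilon$, and $x\cdot e-\xi_t\ge M$ implies $|u(t,x)-p^-(t,x\cdot e)|\le\varepsilon$. *)

(* Defs.v *)
(* MathComp-Analysis, over an arbitrary [R : realType]. *)
From HB Require Import structures.
From mathcomp Require Export all_boot all_order all_algebra.
From mathcomp Require Export all_classical all_reals all_analysis.
Export Order.TTheory GRing.Theory Num.Theory.
Export numFieldNormedType.Exports.

Set Implicit Arguments.
Unset Strict Implicit.
Unset Printing Implicit Defensive.

Local Open Scope classical_set_scope.
Local Open Scope ring_scope.

(* R^N is ['rV[R]_N]; the library norm [`|x|] on it is the max norm, so the
   Euclidean product and norm are defined here. *)
Definition dot (R : realType) (N : nat) (x y : 'rV[R]_N) : R :=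
  \sum_(i < N) x 0 i * y 0 i.

Definition enorm (R : realType) (N : nat) (x : 'rV[R]_N) : R :=
  Num.sqrt (dot x x).

(* Space-time points are pairs [(t, x)]; the partial derivatives are the
   directional derivatives along the coordinate directions of R x R^N. *)
Definition tdir (R : realType) (N : nat) : R * 'rV[R]_N := (1, 0).

Definition xdir (R : realType) (N : nat) (i : 'I_N) : R * 'rV[R]_N :=
  (0, delta_mx 0 i).

Definition dt (R : realType) (N : nat) (u : R * 'rV[R]_N -> R) :
  R * 'rV[R]_N -> R := fun z => 'D_(tdir R N) u z.

Definition dx (R : realType) (N : nat) (i : 'I_N) (u : R * 'rV[R]_N -> R) :
  R * 'rV[R]_N -> R := fun z => 'D_(xdir R i) u z.

Definition globally_bounded (R : realType) (N : nat)
    (u : R * 'rV[R]_N -> R) : Prop :=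
  exists C : R, forall z, `|u z| <= C.

(* The C^{0,beta} norm on the whole of R x R^N (sup norm and Hölder seminorm) is
   at most [C].  Space-time distances are measured in the max norm, which is
   equivalent to the Euclidean one. *)
Definition holder_bound (R : realType) (N : nat) (beta C : R)
    (h : R * 'rV[R]_N -> R) : Prop :=
  (forall z, `|h z| <= C) /\
  (forall z z', `|h z - h z'| <= C * `|z - z'| `^ beta).

Definition class_C0 (R : realType) (N : nat) (beta : R)
    (h : R * 'rV[R]_N -> R) : Prop :=
  exists C : R, holder_bound beta C h.

Definition class_C1 (R : realType) (N : nat) (beta : R)
    (h : R * 'rV[R]_N -> R) : Prop :=
  [/\ globally_bounded h,
      (forall z, derivable h z (tdir R N)) /\ class_C0 beta (dt h) &
      forall i : 'I_N,
        (forall z, derivable h z (xdir R i)) /\ class_C0 beta (dx i h)].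

Definition uniformly_elliptic (R : realType) (N : nat)
    (A : R * 'rV[R]_N -> 'M[R]_N) : Prop :=
  exists alpha1 alpha2 : R,
    0 < alpha1 <= alpha2 /\
    forall z (zeta : 'rV[R]_N),
      alpha1 * enorm zeta ^+ 2
        <= \sum_(i < N) \sum_(j < N) A z i j * zeta 0 i * zeta 0 j
        <= alpha2 * enorm zeta ^+ 2.

Record standing_assumptions (R : realType) (N : nat) (beta : R)
    (A : R * 'rV[R]_N -> 'M[R]_N) (q : R * 'rV[R]_N -> 'rV[R]_N)
    (f : R * 'rV[R]_N -> R -> R) : Prop := StandingAssumptions {
  sa_A_C1 : forall i j, class_C1 beta (fun z => A z i j);
  sa_A_elliptic : uniformly_elliptic A;
  sa_q_C0 : forall i, class_C0 beta (fun z => q z 0 i);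
  sa_f_C0 : forall K : R, exists C : R,
    forall s, `|s| <= K -> holder_bound beta C (fun z => f z s);
  sa_f_lipschitz : forall K : R, exists L : R,
    forall z s s', `|s| <= K -> `|s'| <= K ->
      `|f z s - f z s'| <= L * `|s - s'| }.

Definition class_C12 (R : realType) (N : nat) (u : R * 'rV[R]_N -> R) : Prop :=
  [/\ continuous u,
      (forall z, derivable u z (tdir R N)) /\ continuous (dt u),
      forall i : 'I_N,
        (forall z, derivable u z (xdir R i)) /\ continuous (dx i u) &
      forall i j : 'I_N,
        (forall z, derivable (dx j u) z (xdir R i)) /\
        continuous (dx i (dx j u))].

(* [div_x (A grad_x u)] *)
Definition diffusion (R : realType) (N : nat) (A : R * 'rV[R]_N -> 'M[R]_N)
    (u : R * 'rV[R]_N -> R) : R * 'rV[R]_N -> R :=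
  fun z =>
    \sum_(i < N) dx i (fun z' => \sum_(j < N) A z' i j * dx j u z') z.

Definition classical_solution (R : realType) (N : nat)
    (A : R * 'rV[R]_N -> 'M[R]_N) (q : R * 'rV[R]_N -> 'rV[R]_N)
    (f : R * 'rV[R]_N -> R -> R) (u : R * 'rV[R]_N -> R) : Prop :=
  class_C12 u /\
  forall z,
    dt u z = diffusion A u z + \sum_(i < N) q z 0 i * dx i u z + f z (u z).

(* [(t, x) |-> p(t, x.e)] *)
Definition planar (R : realType) (N : nat) (T : Type) (e : 'rV[R]_N)
    (p : R -> R -> T) : R * 'rV[R]_N -> T :=
  fun z => p z.1 (dot z.2 e).

(* Here [pm], [pp] stand for p^-, p^+; p^+ is the state far behind the moving
   hyperplane x.e = xi_t, on the side x.e - xi_t -> -oo. *)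
Definition transition_wave (R : realType) (N : nat)
    (A : R * 'rV[R]_N -> 'M[R]_N) (q : R * 'rV[R]_N -> 'rV[R]_N)
    (f : R * 'rV[R]_N -> R -> R) (e : 'rV[R]_N) (xi : R -> R)
    (pm pp : R * 'rV[R]_N -> R) (u : R * 'rV[R]_N -> R) : Prop :=
  [/\ classical_solution A q f u,
      ~ (u =1 pm), ~ (u =1 pp) &
      forall eps : R, 0 < eps -> exists2 M : R, 0 <= M &
        forall (t : R) (x : 'rV[R]_N),
          (dot x e - xi t <= - M -> `|u (t, x) - pp (t, x)| <= eps) /\
          (dot x e - xi t >= M -> `|u (t, x) - pm (t, x)| <= eps)].

(* Main.v *)
Require Import Defs.
From mathcomp Require Import ring lra.

Set Implicit Arguments.
Unset Strict Implicit.
Unset Printing Implicit Defensive.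

Local Open Scope classical_set_scope.
Local Open Scope ring_scope.

(** The wave is compared with its translates [u (t, x + zeta)], where
    [dot zeta e >= 0]: such a translate is a subsolution of the equation, because
    [f] is nonincreasing in [x . e]. If every translate lies below [u], then
    opposite translations orthogonal to [e] show that [u] depends on [t] and
    [x . e] only, and translations with [dot zeta e > 0] show that it decreases.

    Two regions have to be treated differently. Far from the front, [u] and its
    translate lie where [f] is nonincreasing in the unknown, so that the
    positive part of their difference is a subsolution of the linear equation.
    This is exploited by [interface_maximum_principle], where the only
    information used near the front is that the front moves with bounded speed.
    For this, [xi] is first replaced by a Lipschitz function at bounded distance
    from it ([lipschitz_front]). The same principle gives
    [pm <= u <= pp], and [u (t, x + zeta) <= u (t, x)] when [dot zeta e] is
    large.

    Near the front, one slides ([sliding]): for a fixed direction [zeta], let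
    [s] be the smallest multiple such that all larger ones are admissible. If
    [s > 0], then [z = u - u (., . + s zeta) >= 0] is a supersolution of a
    linear equation with bounded zeroth-order coefficient, and [z] is bounded
    from below by a positive constant in a strip around the front
    ([strip_positivity]). Hence [s] can be decreased a little without losing the
    inequality in the strip, and the maximum principle extends the inequality
    outside the strip: a contradiction. It matters that [zeta] is fixed: along
    the progression [y + j (s zeta)], which crosses the front, [u] loses
    a fixed amount, so one of finitely many terms [z (y + j (s zeta))] is large.

    To pass from one such point to the whole strip, one needs that [u] is
    uniformly Lipschitz in [x] and that positivity on a ball propagates forward
    in time with explicit constants. Both come from barriers. The Lipschitz
    bound ([symmetric_difference_le]) uses that [A] and [q] depend on [t] alone,
    which makes symmetric differences solutions in one more variable.
    Propagation ([propagation]) uses a compactly supported subsolution on an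
    expanding ball. All these arguments are one test at a maximum point
    ([parab_max]), after a vanishing penalization that makes maxima exist on the
    whole space-time. *)


(** * Euclidean product and quadratic forms *)

Section EuclideanProduct.
Context {R : realType} {N : nat}.
Implicit Types (x y z : 'rV[R]_N) (a : R).

Lemma dotC x y : dot x y = dot y x.
Proof. by apply: eq_bigr => i _; rewrite mulrC. Qed.

Lemma dotDl x y z : dot (x + y) z = dot x z + dot y z.
Proof. by rewrite /dot -big_split; apply: eq_bigr => i _; rewrite !mxE mulrDl. Qed.

Lemma dotZl a x y : dot (a *: x) y = a * dot x y.
Proof. by rewrite /dot big_distrr; apply: eq_bigr => i _; rewrite !mxE -mulrA. Qed.

Lemma dotDr x y z : dot x (y + z) = dot x y + dot x z.
Proof. by rewrite dotC dotDl !(dotC x). Qed.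

Lemma dotZr a x y : dot x (a *: y) = a * dot x y.
Proof. by rewrite dotC dotZl (dotC x). Qed.

Lemma dotNl x y : dot (- x) y = - dot x y.
Proof. by rewrite -scaleN1r dotZl mulN1r. Qed.

Lemma dotNr x y : dot x (- y) = - dot x y.
Proof. by rewrite dotC dotNl dotC. Qed.

Lemma dot0l y : dot 0 y = 0.
Proof. by rewrite -(scale0r 0) dotZl mul0r. Qed.

Lemma dot_ge0 x : 0 <= dot x x.
Proof. by apply: sumr_ge0 => i _; rewrite -expr2 sqr_ge0. Qed.

Lemma sqr_enorm x : enorm x ^+ 2 = dot x x.
Proof. by rewrite sqr_sqrtr // dot_ge0. Qed.

Lemma dot_CS x y : dot x y ^+ 2 <= dot x x * dot y y.
Proof.
have [y0|y0] := eqVneq (dot y y) 0.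
  have h (i : 'I_N) : y 0 i = 0.
    have /eqP := y0; rewrite psumr_eq0 => [|j _]; last by rewrite -expr2 sqr_ge0.
    by move/allP => /(_ i); rewrite mem_index_enum mulf_eq0 orbb => /(_ isT) /eqP.
  rewrite y0 mulr0 [dot x y]big1 ?expr0n // => i _; by rewrite h mulr0.
have yp : 0 < dot y y by rewrite lt_def y0 dot_ge0.
have := dot_ge0 (dot y y *: x - dot x y *: y).
rewrite !(dotDl, dotDr, dotNl, dotNr, dotZl, dotZr) (dotC y x) => h.
have {}h : 0 <= dot y y * (dot x x * dot y y - dot x y ^+ 2) by nra.
by move: h; rewrite pmulr_rge0 // subr_ge0.
Qed.

Lemma sqr_coord_le x i : x 0 i ^+ 2 <= dot x x.
Proof.
rewrite /dot (bigD1 i) //= -expr2 lerDl; apply: sumr_ge0 => j _.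
by rewrite -expr2 sqr_ge0.
Qed.

Lemma normr_le_dot x (rho : R) : 0 <= rho -> dot x x <= rho ^+ 2 -> `|x| <= rho.
Proof.
move=> r0 h; change (mx_norm x <= rho).
have [->//|/mx_norm_neq0[[i j] ->]] := eqVneq (mx_norm x) 0.
rewrite (ord1 i) -ler_sqr ?nnegrE // real_normK ?num_real //.
exact: le_trans (sqr_coord_le x j) h.
Qed.

End EuclideanProduct.

Section Forms.
Context {R : realType} {N : nat}.
Implicit Types (A H : 'M[R]_N) (v p q : 'rV[R]_N) (a : R).

Definition quad H v : R := \sum_i \sum_j H i j * v 0 i * v 0 j.
Definition frob A H : R := \sum_i \sum_j A i j * H i j.

Lemma quadD H H' v : quad (H + H') v = quad H v + quad H' v.
Proof.
rewrite /quad -big_split; apply: eq_bigr => i _ /=.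
by rewrite -big_split; apply: eq_bigr => j _; rewrite !mxE /=; ring.
Qed.

Lemma quadZ a H v : quad (a *: H) v = a * quad H v.
Proof.
rewrite /quad big_distrr; apply: eq_bigr => i _ /=.
by rewrite big_distrr; apply: eq_bigr => j _; rewrite !mxE /=; ring.
Qed.

Lemma quadZv a H v : quad H (a *: v) = a ^+ 2 * quad H v.
Proof.
rewrite /quad big_distrr; apply: eq_bigr => i _ /=.
by rewrite big_distrr; apply: eq_bigr => j _; rewrite !mxE /=; ring.
Qed.

Lemma quad_outer p q v : quad (p^T *m q) v = dot p v * dot q v.
Proof.
rewrite /quad /dot big_distrl; apply: eq_bigr => i _ /=.
rewrite big_distrr; apply: eq_bigr => j _; rewrite !mxE big_ord1 !mxE /=; ring.
Qed.

Lemma quad1 v : quad 1%:M v = dot v v.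
Proof.
apply: eq_bigr => i _; rewrite (bigD1 i) //= big1 => [|j ji].
  by rewrite !mxE eqxx mul1r addr0.
by rewrite !mxE eq_sym (negbTE ji) !mul0r.
Qed.

Lemma frobDr A H H' : frob A (H + H') = frob A H + frob A H'.
Proof.
rewrite /frob -big_split; apply: eq_bigr => i _ /=.
by rewrite -big_split; apply: eq_bigr => j _; rewrite !mxE /=; ring.
Qed.

Lemma frobZr a A H : frob A (a *: H) = a * frob A H.
Proof.
rewrite /frob big_distrr; apply: eq_bigr => i _ /=.
by rewrite big_distrr; apply: eq_bigr => j _; rewrite !mxE /=; ring.
Qed.

Lemma frobC A H : frob A H = frob H A.
Proof. by apply: eq_bigr => i _; apply: eq_bigr => j _; rewrite mulrC. Qed.

Lemma frob_tr A H : frob A^T H^T = frob A H.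
Proof.
by rewrite /frob exchange_big; apply: eq_bigr => i _; apply: eq_bigr => j _; rewrite !mxE.
Qed.

Lemma frob_outer A p : frob A (p^T *m p) = quad A p.
Proof.
by apply: eq_bigr => i _; apply: eq_bigr => j _; rewrite !mxE big_ord1 !mxE mulrA.
Qed.

Lemma frob1 A : frob A 1%:M = \tr A.
Proof.
apply: eq_bigr => i _; rewrite (bigD1 i) //= big1 => [|j ji].
  by rewrite !mxE eqxx mulr1 addr0.
by rewrite !mxE eq_sym (negbTE ji) mulr0.
Qed.

Lemma frob_sub_outer a A H v :
  frob (A - a *: (v^T *m v)) H = frob A H - a * quad H v.
Proof. by rewrite frobC frobDr -scaleNr frobZr frob_outer frobC mulNr. Qed.

Lemma quadB H H' v : quad (H - H') v = quad H v - quad H' v.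
Proof. by rewrite quadD -scaleN1r quadZ mulN1r. Qed.

Lemma frobBr A H H' : frob A (H - H') = frob A H - frob A H'.
Proof. by rewrite frobDr -scaleN1r frobZr mulN1r. Qed.

Definition psd A := forall v, 0 <= quad A v.

Lemma quad_tr A v : quad A^T v = quad A v.
Proof.
rewrite /quad exchange_big; apply: eq_bigr => i _; apply: eq_bigr => j _.
by rewrite !mxE /=; ring.
Qed.

Lemma quad_add_delta A v m x : A^T = A ->
  quad A (v + x *: delta_mx 0 m) =
  quad A v + 2 * x * dot (row m A) v + x ^+ 2 * A m m.
Proof.
move=> sA.
have S i j : A i j = A j i by rewrite -[in LHS]sA mxE.
pose d (i : 'I_N) : R := (i == m)%:R.
have sd (F : 'I_N -> R) : \sum_i F i * d i = F m.
  rewrite (bigD1 m) //= big1 => [|i im]; first by rewrite /d eqxx mulr1 addr0.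
  by rewrite /d (negbTE im) mulr0.
transitivity (\sum_i (\sum_j A i j * v 0 i * v 0 j
   + x * (A m i * v 0 i) + (x * \sum_j A i j * v 0 j + x ^+ 2 * A i m) * d i)).
  apply: eq_bigr => i _.
  transitivity (\sum_j (A i j * v 0 i * v 0 j + (A i j * v 0 i * x) * d j
     + (x * d i * (A i j * v 0 j) + (x ^+ 2 * A i j * d i) * d j))).
    by apply: eq_bigr => j _; rewrite !mxE /= -/(d i) -/(d j); ring.
  rewrite !big_split /= !sd -big_distrr /= (S m i); ring.
rewrite !big_split /= sd -big_distrr /=.
have -> : dot (row m A) v = \sum_j A m j * v 0 j.
  by apply: eq_bigr => j _; rewrite mxE.
rewrite -/(quad A v); ring.
Qed.

Lemma psd_zero_diag A m : A^T = A -> psd A -> A m m = 0 -> row m A = 0.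
Proof.
move=> sA pA a0; apply/rowP => j; rewrite !mxE.
have H x : 0 <= A j j + 2 * x * A m j.
  have := pA (delta_mx 0 j + x *: delta_mx 0 m).
  rewrite quad_add_delta // a0 mulr0 addr0.
  have -> : quad A (delta_mx 0 j) = A j j.
    have := quad_add_delta (0 : 'rV_N) j 1 sA.
    rewrite scale1r add0r => ->; rewrite /quad big1; last first.
      by move=> i _; rewrite big1 // => k _; rewrite !mxE mulr0.
    by rewrite dotC dot0l; ring.
  suff -> : dot (row m A) (delta_mx 0 j) = A m j by [].
  rewrite /dot (bigD1 j) //= big1 => [|i ij]; first by rewrite !mxE !eqxx mulr1 addr0.
  by rewrite !mxE (negbTE ij) mulr0.
apply/eqP/negPn/negP => ne0.
have := H (- (A j j + 1) / (2 * A m j)).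
have -> : 2 * (- (A j j + 1) / (2 * A m j)) * A m j = - (A j j + 1) by field.
lra.
Qed.

(** Gaussian elimination: a symmetric positive semidefinite matrix is a
    nonnegative combination of squares of linear forms, and [frob] of such a
    square against [H] is a value of the form of [H]. The induction removes
    one row and column at a time, from the last one. *)
Lemma frob_le0_sym A H : A^T = A -> psd A -> (forall v, quad H v <= 0) ->
  frob A H <= 0.
Proof.
move=> sA pA nH.
suff gen : forall m (B : 'M[R]_N), B^T = B -> psd B ->
    (forall i j : 'I_N, (m <= i)%N -> B i j = 0) -> frob B H <= 0.
  by apply: (gen N) => // i j; rewrite leqNgt ltn_ord.
elim=> [|m IH] B sB pB zB.
  by rewrite /frob big1 // => i _; rewrite big1 // => j _; rewrite zB ?mul0r.
have S i j : B i j = B j i by rewrite -[in LHS]sB mxE.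
have [mN|mN] := ltnP m N; last first.
  by apply: IH => // i j mi; apply: zB; have := ltn_ord i; rewrite ltnNge (leq_trans mN mi).
pose k := Ordinal mN; pose b := row k B; pose a := B k k.
have a0 : 0 <= a.
  have := pB (0 + 1 *: delta_mx 0 k); rewrite quad_add_delta // dotC dot0l.
  rewrite /quad big1 => [|i _]; last by rewrite big1 // => j _; rewrite !mxE mulr0.
  by rewrite mulr0 !add0r expr1n mul1r.
have [az|anz] := eqVneq a 0.
  apply: IH => // i j; rewrite leq_eqVlt => /orP[/eqP mi|]; last exact: zB.
  have -> : i = k by apply: val_inj; rewrite /= mi.
  by have /rowP/(_ j) := psd_zero_diag sB pB az; rewrite !mxE.
have ap : 0 < a by rewrite lt_def anz a0.
pose B' := B - a^-1 *: (b^T *m b).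
have -> : B = B' + a^-1 *: (b^T *m b) by rewrite /B' subrK.
rewrite frobC frobDr frobZr (frobC H B') frob_outer.
have h1 : frob B' H <= 0.
  apply: IH.
  - rewrite /B' linearB linearZ /= trmx_mul trmxK sB //.
  - move=> v; rewrite /B' quadD -scaleNr quadZ quad_outer.
    have := pB (v + (- (dot b v / a)) *: delta_mx 0 k).
    rewrite quad_add_delta // -/a -/b.
    suff -> : quad B v + 2 * - (dot b v / a) * dot b v + (- (dot b v / a)) ^+ 2 * a
       = quad B v + - a^-1 * (dot b v * dot b v) by [].
    by field.
  - move=> i j; rewrite leq_eqVlt => /orP[/eqP mi|mi].
      have -> : i = k by apply: val_inj; rewrite /= mi.
      by rewrite !mxE big_ord1 !mxE -/a; field.
    by rewrite !mxE big_ord1 !mxE (S k i) (zB i j mi) (zB i k mi); ring.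
have h2 : a^-1 * quad H b <= 0 by rewrite pmulr_rle0 ?invr_gt0.
lra.
Qed.

(** Only the symmetric part of [A] meets a symmetric [H]. *)
Lemma frob_le0 A H : psd A -> H^T = H -> (forall v, quad H v <= 0) ->
  frob A H <= 0.
Proof.
move=> pA sH nH.
have h : frob (A + A^T) H <= 0.
  apply: frob_le0_sym => //.
    by rewrite linearD /= trmxK addrC.
  by move=> v; rewrite quadD quad_tr; have := pA v; lra.
have e : frob A^T H = frob A H by rewrite -{1}sH frob_tr.
move: h; rewrite frobC frobDr !(frobC H) e; lra.
Qed.

End Forms.

(** * Second-order jets and the maximum test *)

Section DirectionalDerivatives.
Context {R : realType} {V : normedModType R}.
Implicit Types (u : V -> R) (z v : V) (a : R).

(** Explicit increments turn translations and restrictions to lines into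
    rewriting steps. *)
Lemma is_derive_epsP u z v a :
  is_derive z v u a <->
  (forall eta : R, 0 < eta -> exists2 d : R, 0 < d & forall h : R, `|h| < d ->
     `|u (z + h *: v) - u z - h * a| <= eta * `|h|).
Proof.
split=> [[du Du] eta eta0|H].
  have := du; rewrite -/(derivable _ _ _) => cu.
  have : (fun h => h^-1 *: ((u \o shift z) (h *: v) - u z)) @ 0^' --> a.
    by rewrite -Du; exact: cu.
  move/cvgrPdist_le => /(_ _ eta0); rewrite near_withinE.
  move/nbhs_ballP => [d /= d0 Hd]; exists d => // h hd.
  have [->|h0] := eqVneq h 0.
    by rewrite scale0r addr0 subrr mul0r subr0 normr0 mulr0.
  have := Hd h; rewrite /ball /= sub0r normrN => /(_ hd h0) {}Hd.
  have -> : u (z + h *: v) - u z - h * a =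
      - (h * (a - h^-1 *: ((u \o shift z) (h *: v) - u z))).
    rewrite /= /shift /= /GRing.scale /= [h *: v + z]addrC; field.
    exact: h0.
  by rewrite normrN normrM mulrC ler_wpM2r.
have cv : (fun h => h^-1 *: ((u \o shift z) (h *: v) - u z)) @ 0^' --> a.
  apply/cvgrPdist_le => eta eta0; have [d d0 Hd] := H _ eta0.
  rewrite near_withinE; apply/nbhs_ballP; exists d => // h.
  rewrite /ball /= sub0r normrN => hd h0.
  have := Hd _ hd.
  have -> : u (z + h *: v) - u z - h * a =
      - (h * (a - h^-1 *: ((u \o shift z) (h *: v) - u z))).
    rewrite /= /shift /= /GRing.scale /= [h *: v + z]addrC; field.
    exact: h0.
  by rewrite normrN normrM mulrC ler_pM2r ?normr_gt0.
split; first by apply/cvg_ex; exists a.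
exact: cvg_lim.
Qed.

End DirectionalDerivatives.

Section SecondOrderTest.
Context {R : realType}.
Implicit Types (phi psi : R -> R) (a b : R).

Lemma is_derive1_epsP phi x a : is_derive x (1 : R) phi a <->
  (forall eta : R, 0 < eta -> exists2 d : R, 0 < d & forall h : R, `|h| < d ->
     `|phi (x + h) - phi x - h * a| <= eta * `|h|).
Proof.
split => [/is_derive_epsP H|H]; [|apply/is_derive_epsP];
  move=> eta /H[d d0 Hd]; exists d => // h /Hd;
  by rewrite (_ : h *: (1 : R) = h) // /GRing.scale /= mulr1.
Qed.

Lemma is_derive_line (V : normedModType R) (u : V -> R) z v s a :
  is_derive (z + s *: v) v u a -> is_derive s (1 : R) (fun r : R => u (z + r *: v)) a.
Proof.
move/is_derive_epsP => H; apply/is_derive1_epsP => eta /H[d d0 Hd].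
by exists d => // h /Hd; rewrite scalerDl addrA.
Qed.

(** Maxima in time are taken over the past only: the final time of a slab may
    be the maximum point. *)
Lemma derive_left_max_ge0 phi a : is_derive (0 : R) (1 : R) phi a ->
  (exists2 d : R, 0 < d & forall s : R, - d < s <= 0 -> phi s <= phi 0) -> 0 <= a.
Proof.
move=> /is_derive1_epsP H [d d0 Hd]; rewrite leNgt; apply/negP => a0.
have [d' d'0 Hd'] : exists2 d : R, 0 < d & forall h : R, `|h| < d ->
     `|phi (0 + h) - phi 0 - h * a| <= (- a / 2) * `|h| by apply: H; lra.
have [m [m0 md md']] : exists m : R, [/\ 0 < m, m < d & m < d'].
  exists (Num.min d d' / 2); have mm0 : 0 < Num.min d d' by rewrite lt_min d0 d'0.
  have h1 : Num.min d d' <= d by rewrite ge_min lexx.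
  have h2 : Num.min d d' <= d' by rewrite ge_min lexx orbT.
  split; lra.
have h1 : phi (- m) <= phi 0 by apply: Hd; lra.
have := Hd' (- m); rewrite normrN gtr0_norm // => /(_ md').
rewrite add0r ler_norml => /andP[h2 _].
have h3 : 0 < - a * m by rewrite mulr_gt0 //; lra.
lra.
Qed.

Lemma derive_max_eq0 phi a : is_derive (0 : R) (1 : R) phi a ->
  (exists2 d : R, 0 < d & forall s : R, `|s| < d -> phi s <= phi 0) -> a = 0.
Proof.
move=> H [d d0 Hd].
have a0 : 0 <= a.
  by apply: (derive_left_max_ge0 H); exists d => // s sd; apply: Hd; rewrite ltr_norml; lra.
suff : 0 <= - a by lra.
have H' : is_derive (0 : R) (1 : R) (fun s => phi (- s)) (- a).
  apply/is_derive1_epsP => eta /((is_derive1_epsP _ _ _).1 H)[d' d'0 Hd'].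
  exists d' => // h hd; have := Hd' (- h); rewrite normrN => /(_ hd).
  by rewrite !add0r oppr0 mulrN mulNr.
apply: (derive_left_max_ge0 H'); exists d => // s sd.
by rewrite oppr0; apply: Hd; rewrite ltr_norml; lra.
Qed.

(** Derivability on the whole line, rather than near 0, makes the notion
    stable under products and compositions without bookkeeping of neighborhoods. *)
Definition derive2_at0 phi a b := exists2 dphi : R -> R,
  (forall s, is_derive s (1 : R) phi (dphi s)) /\ dphi 0 = a &
  is_derive (0 : R) (1 : R) dphi b.

(** If [b] were positive, the derivative would be positive just after 0, and
    the mean value theorem would make [phi] exceed [phi 0]. *)
Lemma derive2_at0_max phi a b : derive2_at0 phi a b ->
  (exists2 d : R, 0 < d & forall s : R, `|s| < d -> phi s <= phi 0) -> a = 0 /\ b <= 0.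
Proof.
move=> [dphi [H <-] H2] [d d0 Hd].
have z : dphi 0 = 0 by apply: (derive_max_eq0 (H 0)); exists d.
split=> //; rewrite leNgt; apply/negP => b0.
have [d' d'0 Hd'] := (is_derive1_epsP _ _ _).1 H2 (b / 2) ltac:(lra).
have [m [m0 md md']] : exists m : R, [/\ 0 < m, m < d & m < d'].
  exists (Num.min d d' / 2); have mm0 : 0 < Num.min d d' by rewrite lt_min d0 d'0.
  have h1 : Num.min d d' <= d by rewrite ge_min lexx.
  have h2 : Num.min d d' <= d' by rewrite ge_min lexx orbT.
  split; lra.
have [c] : exists2 c, c \in `]0, m[ & phi m - phi 0 = dphi c * (m - 0).
  apply: MVT => //.
  apply: continuous_subspaceT => x.
  by apply: differentiable_continuous; apply/derivable1_diffP; case: (H x).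
rewrite in_itv /= subr0 => /andP[c0 cm] e.
have h1 : phi m <= phi 0 by apply: Hd; rewrite gtr0_norm.
have := Hd' c; rewrite gtr0_norm // => /(_ (lt_trans cm md')).
rewrite add0r z subr0 ler_norml => /andP[h2 _].
have h4 : 0 < b * c by exact: mulr_gt0.
have h3 : 0 < dphi c by lra.
have h5 := mulr_gt0 h3 m0; lra.
Qed.

Lemma derive2_at0_ext phi psi a b : phi =1 psi -> derive2_at0 phi a b -> derive2_at0 psi a b.
Proof. by move/funext ->. Qed.

Lemma derive2_at0D phi psi a b c d :
  derive2_at0 phi a b -> derive2_at0 psi c d -> derive2_at0 (phi + psi) (a + c) (b + d).
Proof.
move=> [dphi [H <-] H2] [dpsi [K <-] K2]; exists (dphi + dpsi).
  by split=> // s; apply: is_deriveD.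
exact: is_deriveD.
Qed.

Lemma derive2_at0Z k phi a b : derive2_at0 phi a b -> derive2_at0 (k *: phi) (k * a) (k * b).
Proof.
move=> [dphi [H <-] H2]; exists (k *: dphi).
  by split=> // s; apply: is_deriveZ.
exact: is_deriveZ.
Qed.

Lemma derive2_at0M phi psi a b c d :
  derive2_at0 phi a b -> derive2_at0 psi c d ->
  derive2_at0 (phi * psi) (phi 0 * c + psi 0 * a)
    (phi 0 * d + psi 0 * b + 2 * a * c).
Proof.
move=> [dphi [H <-] H2] [dpsi [K <-] K2].
exists (phi * dpsi + psi * dphi).
  split=> // s; exact: is_deriveM.
have -> : phi 0 * d + psi 0 * b + 2 * dphi 0 * dpsi 0 =
  (phi 0 * d + dpsi 0 * dphi 0) + (psi 0 * b + dphi 0 * dpsi 0) by ring.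
by apply: is_deriveD; apply: is_deriveM.
Qed.

Lemma derive2_at0_cst c : derive2_at0 (cst c) 0 0.
Proof. exists (cst 0); first split=> // s; exact: is_derive_cst. Qed.

Lemma derive2_at0_affine c m : derive2_at0 (fun s => c + s * m) m 0.
Proof.
exists (cst m); last exact: is_derive_cst.
split=> // s; apply/is_derive1_epsP => eta eta0.
exists 1 => // h _.
have -> : c + (s + h) * m - (c + s * m) - h * m = 0 by ring.
by rewrite normr0 mulr_ge0 // ltW.
Qed.

Lemma derive2_at0_exp phi a b : derive2_at0 phi a b ->
  derive2_at0 (expR \o phi) (expR (phi 0) * a) (expR (phi 0) * (b + a ^+ 2)).
Proof.
move=> [dphi [H <-] H2].
have E s : is_derive s (1 : R) (expR \o phi) (expR (phi s) * dphi s).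
  exact: is_derive1_comp.
exists ((expR \o phi) * dphi); first by split=> // s; exact: E.
have -> : expR (phi 0) * (b + dphi 0 ^+ 2) =
  expR (phi 0) * b + dphi 0 * (expR (phi 0) * dphi 0) by ring.
exact: is_deriveM.
Qed.

End SecondOrderTest.

Section Jets.
Context {R : realType} {N : nat}.
Implicit Types (g h : R * 'rV[R]_N -> R) (z : R * 'rV[R]_N) (p : 'rV[R]_N).
Implicit Types (H : 'M[R]_N) (tau : R).

(** Second derivatives are only required along lines, through the quadratic
    form of [H]: the test at a maximum uses nothing else, and the notion is
    preserved by sums, products and the exponential. A symmetric [H] is
    determined by its form. *)
Definition jet g z tau p H :=
  [/\ is_derive (0 : R) (1 : R) (fun s => g (z.1 + s, z.2)) tau,
      forall v, derive2_at0 (fun s => g (z.1, z.2 + s *: v)) (dot p v) (quad H v) &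
      H^T = H].

Lemma jetD g h z tau tau' p p' H H' : jet g z tau p H -> jet h z tau' p' H' ->
  jet (g + h) z (tau + tau') (p + p') (H + H').
Proof.
move=> [a b c] [a' b' c']; split; first exact: is_deriveD.
  by move=> v; rewrite dotDl quadD; exact: derive2_at0D.
by rewrite linearD /= c c'.
Qed.

Lemma jetZ k g z tau p H : jet g z tau p H -> jet (k *: g) z (k * tau) (k *: p) (k *: H).
Proof.
move=> [a b c]; split; first exact: is_deriveZ.
  by move=> v; rewrite dotZl quadZ; exact: derive2_at0Z.
by rewrite linearZ /= c.
Qed.

Lemma jetB g h z tau tau' p p' H H' : jet g z tau p H -> jet h z tau' p' H' ->
  jet (g - h) z (tau - tau') (p - p') (H - H').
Proof.
move=> J J'; have := jetD J (jetZ (-1) J').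
by rewrite !scaleN1r mulN1r.
Qed.

Lemma jetM g h z tau tau' p p' H H' : jet g z tau p H -> jet h z tau' p' H' ->
  jet (g * h) z (g z * tau' + h z * tau) (g z *: p' + h z *: p)
    (g z *: H' + h z *: H + (p^T *m p' + p'^T *m p)).
Proof.
case: z => t x [a b c] [a' b' c']; split.
- have := is_deriveM a a'; rewrite /= addr0; exact.
- move=> v; have := derive2_at0M (b v) (b' v); rewrite /= scale0r addr0.
  rewrite dotDl !dotZl !quadD !quadZ !quad_outer => e.
  have -> : dot p v * dot p' v + dot p' v * dot p v = 2 * dot p v * dot p' v by ring.
  exact: e.
- by rewrite !linearD !linearZ /= !trmx_mul !trmxK c c' [p^T *m p' + _]addrC.
Qed.

Lemma jet_exp g z tau p H : jet g z tau p H ->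
  jet (expR \o g) z (expR (g z) * tau) (expR (g z) *: p)
    (expR (g z) *: (H + p^T *m p)).
Proof.
case: z => t x [a b c]; split.
- have e : is_derive (g (t + 0, x)) (1 : R) expR (expR (g (t + 0, x))) by exact: is_derive_expR.
  by have := is_derive1_comp e a; rewrite /= addr0.
- move=> v; have := derive2_at0_exp (b v); rewrite /= scale0r addr0.
  by rewrite dotZl quadZ quadD quad_outer expr2.
- by rewrite linearZ linearD /= trmx_mul trmxK c.
Qed.

Lemma jet_cst c z : jet (cst c) z 0 0 0.
Proof.
split; [exact: is_derive_cst| |by rewrite trmx0] => v.
rewrite dot0l (_ : quad 0 v = 0); first exact: (derive2_at0_cst c).
by rewrite -(scale0r 0) quadZ mul0r.
Qed.

Lemma jet_of_time (phi : R -> R) z a : is_derive z.1 (1 : R) phi a ->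
  jet (fun z => phi z.1) z a 0 0.
Proof.
move=> H; have [_ h1 h2] := jet_cst (phi z.1) z; split => //=.
apply/is_derive1_epsP => ep /((is_derive1_epsP _ _ _).1 H)[d d0 Hd].
by exists d => // h /Hd; rewrite add0r addr0.
Qed.

Lemma jet_time z : jet (fun z => z.1) z 1 0 0.
Proof.
have [_ h1 h2] := jet_cst z.1 z; split => //=.
apply/is_derive1_epsP => eta eta0; exists 1 => // h _.
have -> : z.1 + (0 + h) - (z.1 + 0) - h * 1 = 0 by ring.
by rewrite normr0 mulr_ge0 // ltW.
Qed.

Lemma jet_dot e z : jet (fun z => dot z.2 e) z 0 e 0.
Proof.
have [h1 _ h2] := jet_cst (dot z.2 e) z; split => //= v.
rewrite (_ : quad 0 v = 0) ; last by rewrite -(scale0r 0) quadZ mul0r.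
apply: derive2_at0_ext (derive2_at0_affine (dot z.2 e) (dot e v)) => s.
by rewrite dotDl dotZl (dotC v).
Qed.

Lemma jet_sqr_dist y z : jet (fun z => dot (z.2 - y) (z.2 - y)) z
  0 (2 *: (z.2 - y)) (2 *: 1%:M).
Proof.
case: z => t x /=.
split=> /=; first exact: is_derive_cst.
  move=> v; rewrite dotZl quadZ quad1.
  pose d := dot (x - y) (x - y).
  have h0 : derive2_at0 (fun s : R => s) 1 0.
    by apply: derive2_at0_ext (derive2_at0_affine 0 1) => s; rewrite add0r mulr1.
  have h := derive2_at0D (derive2_at0_affine d (2 * dot (x - y) v))
                     (derive2_at0Z (dot v v) (derive2_at0M h0 h0)).
  have -> : 2 * dot (x - y) v = 2 * dot (x - y) v + dot v v * (0 * 1 + 0 * 1) by ring.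
  have -> : 2 * dot v v = 0 + dot v v * (0 * 0 + 0 * 0 + 2 * 1 * 1) by ring.
  apply: derive2_at0_ext h => s.
  transitivity (d + s * (2 * dot (x - y) v) + dot v v * (s * s)) => //.
  rewrite (_ : x + s *: v - y = (x - y) + s *: v); last by rewrite addrAC.
  rewrite [RHS]dotDl !(dotDr _ (x - y)) !dotZl !dotZr (dotC v (x - y)) -/d; ring.
by rewrite linearZ /= trmx1.
Qed.

Lemma jet_shift g z tau p H y : jet g (z.1, z.2 + y) tau p H ->
  jet (fun z => g (z.1, z.2 + y)) z tau p H.
Proof.
move=> [a b c]; split=> // v.
apply: derive2_at0_ext (b v) => s /=.
by rewrite addrAC.
Qed.

Lemma jet_max g z tau p H : jet g z tau p H ->
  (\forall z' \near z, z'.1 <= z.1 -> g z' <= g z) ->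
  [/\ 0 <= tau, p = 0 & forall v, quad H v <= 0].
Proof.
case: z => t x [/= a b c] mx.
have [d d0 Hd] : exists2 d : R, 0 < d & forall t' x', `|t' - t| < d -> `|x' - x| < d ->
    t' <= t -> g (t', x') <= g (t, x).
  move: mx => /nbhs_ballP[d /= d0 Hd]; exists d => // t' x' h1 h2 h3.
  apply: Hd => //; split => /=; first by rewrite /ball /= distrC.
  by rewrite mx_norm_ball /ball_ /= distrC.
have sp v : dot p v = 0 /\ quad H v <= 0.
  apply: (derive2_at0_max (b v)).
  have v1 : 0 < 1 + `|v| by rewrite ltr_wpDr.
  exists (d / (1 + `|v|)); first exact: divr_gt0.
  move=> s; rewrite ltr_pdivlMr // => hs; rewrite scale0r addr0; apply: Hd => //.
    by rewrite subrr normr0.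
  rewrite [x + _]addrC addrK normrZ (le_lt_trans _ hs) //.
  by rewrite ler_wpM2l // lerDr.
split; last by move=> v; case: (sp v).
  apply: (derive_left_max_ge0 a); exists d => // s /andP[s1 s2].
  rewrite addr0; apply: Hd; last lra.
    by rewrite [t + s]addrC addrK ltr_norml; lra.
  by rewrite subrr normr0.
apply/rowP => i; rewrite mxE.
have [<- _] := sp (delta_mx 0 i).
rewrite /dot (bigD1 i) //= big1 => [|j ji]; first by rewrite !mxE !eqxx mulr1 addr0.
by rewrite !mxE (negbTE ji) mulr0.
Qed.

End Jets.

(** * Jets of classical solutions *)

Section MeanValue.
Context {R : realType} {V : normedModType R}.
Implicit Types (u : V -> R) (y z v w a b : V).

Lemma is_derive_lineP u z v (l : R) :
  is_derive z v u l <-> is_derive (0 : R) (1 : R) (fun r : R => u (z + r *: v)) l.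
Proof.
split=> [H|/is_derive1_epsP H].
  by apply: is_derive_line; rewrite scale0r addr0.
apply/is_derive_epsP => eta /H[d d0 Hd]; exists d => // h /Hd.
by rewrite add0r scale0r addr0.
Qed.

Lemma mvt_line u w z (r : R) : (forall y, derivable u y w) ->
  exists2 c : R, `|c| <= `|r| & u (z + r *: w) - u z = r * 'D_w u (z + c *: w).
Proof.
move=> du.
have dl s : is_derive s (1 : R) (fun s : R => u (z + s *: w)) ('D_w u (z + s *: w)).
  by apply: is_derive_line; apply: derivableP.
have cl : continuous (fun s : R => u (z + s *: w)).
  move=> s; apply: differentiable_continuous.
  by apply/derivable1_diffP; case: (dl s).
have [r0|r0] := leP 0 r.
  have [|c] := @MVT_segment R (fun s => u (z + s *: w)) _ 0 r r0 (fun s _ => dl s).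
    exact: continuous_subspaceT.
  rewrite in_itv /= scale0r addr0 subr0 mulrC => /andP[c0 cr] e.
  by exists c => //; rewrite !ger0_norm.
have [|c] := @MVT_segment R (fun s => u (z + s *: w)) _ r 0 (ltW r0) (fun s _ => dl s).
  exact: continuous_subspaceT.
rewrite in_itv /= scale0r addr0 sub0r => /andP[c0 cr] e.
exists c; first by rewrite ler0_norm // ltr0_norm // lerN2.
by rewrite -opprB e mulrN opprK mulrC.
Qed.

Lemma derivable_shift u w b y : derivable u (y + b) w ->
  is_derive y w (fun y => u (y + b)) ('D_w u (y + b)).
Proof.
move/derivableP/is_derive_lineP => H; apply/is_derive_lineP.
suff -> : (fun r : R => u (y + r *: w + b)) = (fun r : R => u (y + b + r *: w)) by [].
by apply/funext => r; rewrite addrAC.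
Qed.

(** The second difference quotient along [a] and [b] is, by the mean value
    theorem applied in either order, a value near [z] of one mixed derivative or
    of the other. *)
Lemma schwarz u a b z :
  (forall y, derivable u y a) -> (forall y, derivable u y b) ->
  (forall y, derivable ('D_a u) y b) -> (forall y, derivable ('D_b u) y a) ->
  {for z, continuous ('D_b ('D_a u))} -> {for z, continuous ('D_a ('D_b u))} ->
  'D_b ('D_a u) z = 'D_a ('D_b u) z.
Proof.
move=> da db dab dba cab cba.
have key (a' b' : V) (h : R) : (forall y, derivable u y a') ->
    (forall y, derivable ('D_a' u) y b') ->
    exists c d : R, [/\ `|c| <= `|h|, `|d| <= `|h| &
      u (z + h *: a' + h *: b') - u (z + h *: a') - (u (z + h *: b') - u z)
      = h * (h * 'D_b' ('D_a' u) (z + c *: a' + d *: b'))].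
  move=> du ddu; pose U y := u (y + h *: b') - u y.
  have dU y : is_derive y a' U ('D_a' u (y + h *: b') - 'D_a' u y).
    exact: (is_deriveB (derivable_shift (du _)) (derivableP (du y))).
  have [c ch e] := @mvt_line U a' z h (fun y => let: DeriveDef H _ := dU y in H).
  have [d dh e'] := @mvt_line ('D_a' u) b' (z + c *: a') h ddu.
  exists c, d; split=> //; rewrite -e'; move: e; rewrite (derive_val (is_derive := dU _)).
  by rewrite /U => ->.
apply/eqP; rewrite -subr_eq0 -normr_le0; apply/ler_addgt0Pr => eta eta0.
rewrite add0r.
have e2 : 0 < eta / 2 by lra.
move/cvgrPdist_le: cab => /(_ _ e2) /nbhs_ballP[d1 /= d10 H1].
move/cvgrPdist_le: cba => /(_ _ e2) /nbhs_ballP[d2 /= d20 H2].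
pose m := Num.min d1 d2.
have m0 : 0 < m by rewrite lt_min d10 d20.
have S0 : 0 < 1 + `|a| + `|b| by rewrite ltr_wpDr // ltr_wpDr.
pose h := m / (1 + `|a| + `|b|) / 2.
have h0 : 0 < h by rewrite /h !divr_gt0.
have near (c d M : R) : `|c| <= `|h| -> `|d| <= `|h| -> m <= M ->
    ball z M (z + (c *: a + d *: b)).
  rewrite (gtr0_norm h0) => ch dh mM.
  rewrite -ball_normE /= opprD addrA subrr sub0r normrN.
  apply: lt_le_trans mM.
  apply: (@le_lt_trans _ _ (h * (1 + `|a| + `|b|))).
    rewrite (le_trans (ler_normD _ _)) // !normrZ mulrDr mulrDr mulr1 lerD //.
      by rewrite ler_wpDl ?ler_wpM2r // ltW.
    by rewrite ler_wpM2r.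
  rewrite /h mulrAC divfK ?gt_eqF //; lra.
have [c [d [ch dh e]]] := key a b h da dab.
have [c' [d' [ch' dh' e']]] := key b a h db dba.
have hh : 'D_b ('D_a u) (z + c *: a + d *: b) = 'D_a ('D_b u) (z + c' *: b + d' *: a).
  apply: (mulfI (lt0r_neq0 h0)); apply: (mulfI (lt0r_neq0 h0)).
  apply: etrans (esym e) _; apply: etrans _ e'.
  have arith (k l m' n : R) : k - l - (m' - n) = k - m' - (l - n) by ring.
  by rewrite [z + h *: a + _]addrAC; exact: arith.
have B1 : `|'D_b ('D_a u) z - 'D_b ('D_a u) (z + c *: a + d *: b)| <= eta / 2.
  by apply: H1; rewrite -addrA; apply: near; rewrite ?/m ?ge_min ?lexx.
have B2 : `|'D_a ('D_b u) z - 'D_a ('D_b u) (z + c' *: b + d' *: a)| <= eta / 2.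
  apply: H2; rewrite -addrA [c' *: b + _]addrC.
  by apply: near; rewrite ?/m ?ge_min ?lexx ?orbT.
rewrite -hh distrC in B2; rewrite [eta]splitr.
exact: le_trans (ler_distD _ _ _) (lerD B1 B2).
Qed.

End MeanValue.

Section JetsOfSolutions.
Context {R : realType} {N : nat}.
Implicit Types (u g : R * 'rV[R]_N -> R) (z : R * 'rV[R]_N) (v : 'rV[R]_N).

(** Continuous partial derivatives give derivatives in every space direction:
    the increment is a telescoping sum of increments along coordinate axes. *)
Lemma derive_space g v z :
  (forall i z, derivable g z (xdir R i)) -> (forall i, continuous (dx i g)) ->
  is_derive z ((0, v) : R * 'rV[R]_N) g (\sum_i v 0 i * dx i g z).
Proof.
move=> dg cg; apply/is_derive_epsP => eta eta0.
pose S := 1 + \sum_i `|v 0 i|.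
have S0 : 0 < S by rewrite ltr_wpDr // sumr_ge0.
have : \forall z' \near z, forall i, `|dx i g z - dx i g z'| <= eta / S.
  apply: (@filter_forall _ _ (fun i z' => `|dx i g z - dx i g z'| <= eta / S)
     (nbhs z)) => i.
  by move/cvgrPdist_le: (cg i z); apply; exact: divr_gt0.
move=> /nbhs_ballP[d /= d0 Hd].
have v1 : 0 < 1 + `|v| by rewrite ltr_wpDr.
exists (d / (1 + `|v|)); first exact: divr_gt0.
move=> h; rewrite ltr_pdivlMr // => hd.
pose w k : R * 'rV[R]_N := (0, \row_(i < N) (if (i < k)%N then v 0 i else 0)).
have small k (c : R) (i : 'I_N) : `|c| <= `|h * v 0 i| -> (i : nat) = k ->
    ball z d (z + h *: w k + c *: xdir R i).
  move=> ch ik; rewrite -ball_normE /= -addrA opprD addrA subrr sub0r normrN.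
  rewrite (le_lt_trans _ hd) // prod_normE /= !scaler0 addr0 normr0.
  rewrite ge_max mulr_ge0 ?(ltW v1) //=.
  pose X : 'rV[R]_N := h *: (\row_l (if (l < k)%N then v 0 l else 0)) + c *: delta_mx 0 i.
  change (mx_norm X <= `|h| * (1 + `|v|)).
  have [->|X0] := eqVneq (mx_norm X) 0; first by rewrite mulr_ge0 ?(ltW v1).
  have [[i0 j] ->] := mx_norm_neq0 X0.
  rewrite (ord1 i0) !mxE /= {i0}.
  have vj l : `|v 0 l| <= `|v|.
    have -> : `|v| = \big[Num.max/0]_ij `|v ij.1 ij.2| by exact: mx_normrE.
    exact: (le_bigmax _ (fun ij : 'I_1 * 'I_N => `|v ij.1 ij.2|) (0, l)).
  have vj' l : `|h * v 0 l| <= `|h| * (1 + `|v|).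
    by rewrite normrM ler_wpM2l // ler_wpDl.
  have [ji|ji] := eqVneq j i.
    by rewrite ji ik ltnn mulr0 add0r mulr1 (le_trans ch).
  rewrite mulr0 addr0; case: ifP => _; first exact: vj'.
  by rewrite mulr0 normr0 mulr_ge0 ?(ltW v1).
have step k : (k <= N)%N ->
  `|g (z + h *: w k) - g z - h * (\sum_(i < N | (i < k)%N) v 0 i * dx i g z)|
   <= eta / S * `|h| * (\sum_(i < N | (i < k)%N) `|v 0 i|).
  elim: k => [_|k IH kN].
    have -> : w 0%N = 0 by congr pair; apply/rowP => i; rewrite !mxE.
    by rewrite scaler0 addr0 subrr !big_pred0 // !mulr0 subr0 normr0.
  have {}IH := IH (ltnW kN).
  pose i := Ordinal kN.
  have wk : z + h *: w k.+1 = z + h *: w k + (h * v 0 i) *: xdir R i.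
    rewrite -addrA; congr (_ + _); congr pair; first by rewrite /= !scaler0 addr0.
    apply/rowP => j; rewrite !mxE /= ltnS leq_eqVlt.
    have -> : (j == i) = (j == k :> nat) by [].
    have [jk|jk] := eqVneq (j : nat) k.
      rewrite jk ltnn mulr0 add0r mulr1 /=.
      by congr (_ * v 0 _); apply: val_inj => /=.
    by rewrite mulr0 addr0.
  have [c ch e] := @mvt_line R _ g (xdir R i) (z + h *: w k) (h * v 0 i) (dg i).
  have B := Hd _ (small k c i ch erefl) i.
  have sumS (F : 'I_N -> R) : \sum_(j < N | (j < k.+1)%N) F j
     = F i + \sum_(j < N | (j < k)%N) F j.
    rewrite (bigD1 i) //=; congr (_ + _); apply: eq_bigl => j.
    rewrite ltnS leq_eqVlt; have -> : (j == i) = (j == k :> nat) by [].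
    by case: eqVneq => [->|]; rewrite ?ltnn //= ?andbT.
  rewrite !sumS wk.
  have -> : g (z + h *: w k + (h * v 0 i) *: xdir R i) - g z -
      h * (v 0 i * dx i g z + \sum_(j < N | (j < k)%N) v 0 j * dx j g z) =
     (g (z + h *: w k) - g z - h * (\sum_(j < N | (j < k)%N) v 0 j * dx j g z))
     + (h * v 0 i) * ('D_(xdir R i) g (z + h *: w k + c *: xdir R i) - dx i g z).
    rewrite mulrBr -e; ring.
  rewrite (le_trans (ler_normD _ _)) // addrC [leRHS]mulrDr lerD //.
  rewrite normrM normrM mulrC -mulrA.
  by rewrite ler_wpM2r ?mulr_ge0 // distrC.
have := step N (leqnn N).
have -> : w N = (0, v).
  by congr pair; apply/rowP => i; rewrite mxE ltn_ord.
have e (F : 'I_N -> R) : \sum_(i < N | (i < N)%N) F i = \sum_i F i.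
  by apply: eq_bigl => i; rewrite ltn_ord.
rewrite !e => /le_trans; apply.
rewrite mulrAC ler_wpM2r // mulrAC ler_pdivrMr // ler_wpM2l //; first exact: ltW.
by rewrite /S lerDr.
Qed.

(** Schwarz's theorem enters here: [A] need not be symmetric, so that the sign
    of its contraction with the Hessian depends on the symmetry of the latter. *)
Lemma C12_jet u z : class_C12 u ->
  jet u z (dt u z) (\row_i dx i u z) (\matrix_(i, j) dx i (dx j u) z).
Proof.
move=> [cu [dtu cdt] Hx Hxx]; case: z => t x.
have line v s : (t, x + s *: v) = (t, x) + s *: ((0, v) : R * 'rV[R]_N).
  by congr pair; rewrite /= scaler0 addr0.
split.
- have /is_derive_lineP := derivableP (dtu (t, x)).
  suff -> : (fun s : R => u ((t, x).1 + s, (t, x).2)) = (fun r => u ((t, x) + r *: tdir R N)) by [].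
  apply/funext => s; congr u; congr pair; last by rewrite /= scaler0 addr0.
  by rewrite /= [s *: _]mulr1.
- move=> v; exists (fun s => \sum_i v 0 i * dx i u (t, x + s *: v)).
    split; last first.
      rewrite scale0r addr0; apply: eq_bigr => i _; by rewrite mxE mulrC.
    move=> s.
    have := @derive_space u v (t, x + s *: v) (fun i => (Hx i).1) (fun i => (Hx i).2).
    rewrite line => /is_derive_line.
    suff -> : (fun r : R => u ((t, x) + r *: ((0, v) : R * 'rV[R]_N))) =
     (fun s => u ((t, x).1, (t, x).2 + s *: v)) by [].
    by apply/funext => r; rewrite -line.
  have H i : is_derive (0 : R) (1 : R) (fun s => v 0 i * dx i u (t, x + s *: v))
      (v 0 i * \sum_j v 0 j * dx j (dx i u) (t, x)).
    have := @derive_space (dx i u) v (t, x) (fun j => (Hxx j i).1) (fun j => (Hxx j i).2).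
    move/is_derive_lineP/(is_deriveZ (v 0 i)).
    suff -> : (fun s => v 0 i * dx i u (t, x + s *: v)) =
      v 0 i *: (fun r : R => dx i u ((t, x) + r *: ((0, v) : R * 'rV[R]_N))) by [].
    by apply/funext => r; rewrite line.
  have := is_derive_sum H; rewrite fct_sumE.
  suff -> : quad (\matrix_(i, j) dx i (dx j u) (t, x)) v =
     \sum_(i < N) v 0 i * (\sum_j v 0 j * dx j (dx i u) (t, x)) by [].
  rewrite /quad exchange_big; apply: eq_bigr => i _.
  by rewrite big_distrr; apply: eq_bigr => j _; rewrite !mxE /=; ring.
- apply/matrixP => i j; rewrite !mxE.
  apply: schwarz; [exact: (Hx i).1|exact: (Hx j).1|exact: (Hxx j i).1|
    exact: (Hxx i j).1|exact: (Hxx j i).2|exact: (Hxx i j).2].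
Qed.

Lemma solution_jet (A : R -> 'M[R]_N) (q : R -> 'rV[R]_N)
    (f : R * 'rV[R]_N -> R -> R) u z :
  classical_solution (fun z => A z.1) (fun z => q z.1) f u ->
  exists tau p H, jet u z tau p H /\
    tau = frob (A z.1) H + dot (q z.1) p + f z (u z).
Proof.
move=> [C E]; do 3 eexists; split; first exact: C12_jet.
case: C => _ _ Hx Hxx.
rewrite E; congr (_ + _ + _); last by apply: eq_bigr => i _; rewrite !mxE.
apply: eq_bigr => i _.
have H : is_derive z (xdir R i) (fun z' => \sum_j A z'.1 i j * dx j u z')
   (\sum_j A z.1 i j * dx i (dx j u) z).
  apply/is_derive_lineP.
  have K j : is_derive (0 : R) (1 : R)
      (fun s => A z.1 i j * dx j u (z + s *: xdir R i)) (A z.1 i j * dx i (dx j u) z).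
    have /derivableP/is_derive_lineP/(is_deriveZ (A z.1 i j)) := (Hxx i j).1 z.
    exact.
  have := is_derive_sum K; rewrite fct_sumE.
  suff -> : (fun r : R => \sum_j A (z + r *: xdir R i).1 i j * dx j u (z + r *: xdir R i))
   = (fun x0 => \sum_(i0 < N) A z.1 i i0 * dx i0 u (z + x0 *: xdir R i)) by [].
  by apply/funext => r; rewrite /= scaler0 addr0.
rewrite {1}/dx (derive_val (is_derive := H)).
by apply: eq_bigr => j _; rewrite mxE.
Qed.

End JetsOfSolutions.

(** * The parabolic operator and the existence of maxima *)

Lemma continuous_pair (T U V : topologicalType) (f : T -> U) (g : T -> V) :
  continuous f -> continuous g -> continuous (fun x => (f x, g x)).
Proof.
move=> cf cg x.
exact: (@cvg_pair _ _ _ (nbhs x) (nbhs (f x)) (nbhs (g x)) _ _ _ f g (cf x) (cg x)).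
Qed.

Lemma continuous_composite (T U V : topologicalType) (f : T -> U) (g : U -> V) :
  continuous f -> continuous g -> continuous (fun x => g (f x)).
Proof. by move=> cf cg x; apply: (cvg_comp f g); [exact: cf|exact: cg]. Qed.

Section Maxima.
Context {R : realType} {N : nat}.
Implicit Types (z : R * 'rV[R]_N) (x : 'rV[R]_N).

Lemma continuous_dot (T : topologicalType) (F G : T -> 'rV[R]_N) :
  continuous F -> continuous G -> continuous (fun y => dot (F y) (G y)).
Proof.
move=> cF cG; rewrite /dot; apply: continuous_big => [p|i _ y].
  by apply: cvgD; [exact: cvg_fst|exact: cvg_snd].
apply: cvgM.
  by apply: (cvg_comp F (fun M : 'rV[R]_N => M 0 i)); [exact: cF|exact: coord_continuous].
by apply: (cvg_comp G (fun M : 'rV[R]_N => M 0 i)); [exact: cG|exact: coord_continuous].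
Qed.

Definition sqn z : R := z.1 ^+ 2 + dot z.2 z.2.

Lemma continuous_time : continuous (fun z : R * 'rV[R]_N => z.1).
Proof. by move=> z; exact: cvg_fst. Qed.

Lemma continuous_space : continuous (fun z : R * 'rV[R]_N => z.2).
Proof. by move=> z; exact: cvg_snd. Qed.

Lemma continuous_sqn : continuous sqn.
Proof.
move=> z; apply: cvgD; last exact: (continuous_dot continuous_space continuous_space).
under eq_fun do rewrite expr2.
by rewrite expr2; apply: cvgM; exact: continuous_time.
Qed.

Lemma sqn_ge0 z : 0 <= sqn z.
Proof. by rewrite addr_ge0 ?sqr_ge0 ?dot_ge0. Qed.

Definition box (T : R) : set (R * 'rV[R]_N) :=
  `[- T, T] `*` [set x : 'rV[R]_N | forall i : 'I_N, (`[- T, T]%classic : set R) (x ord0 i)].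

Lemma compact_box T : compact (box T).
Proof.
apply: compact_setX; first exact: segment_compact.
apply: (@rV_compact R N (fun=> `[- T, T]%classic)) => i.
exact: segment_compact.
Qed.

Lemma sqn_box T z : 0 <= T -> sqn z <= T ^+ 2 -> box T z.
Proof.
move=> T0 h.
have itv (a : R) : a ^+ 2 <= sqn z -> a \in `[- T, T].
  move=> ha; rewrite in_itv /= -ler_norml -ler_sqr ?nnegrE //.
  by rewrite real_normK ?num_real // (le_trans ha).
split=> /= [|i]; apply: itv; rewrite /sqn.
  by rewrite lerDl dot_ge0.
by rewrite (le_trans (sqr_coord_le z.2 i)) // lerDr sqr_ge0.
Qed.

(** Outside a large box the function is below one of its values, and boxes are
    compact. The parameter in [K] serves the doubling of variables in the
    Lipschitz bound; a one-point [K] gives maxima over space-time. *)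
Lemma coercive_max (S : topologicalType) (K : set S)
    (G : S * (R * 'rV[R]_N) -> R) (C eps : R) :
  K !=set0 -> compact K -> continuous G -> 0 < eps ->
  (forall w, K w.1 -> G w <= C - eps * sqn w.2) ->
  exists2 w, K w.1 & forall w', K w'.1 -> G w' <= G w.
Proof.
move=> [s Ks] cK cG eps0 hG.
pose w0 : S * (R * 'rV[R]_N) := (s, 0).
pose T := 1 + `|C - G w0| / eps.
have T1 : 1 <= T by rewrite lerDl divr_ge0 // ltW.
have T0 : 0 <= T by lra.
have inb w : K w.1 -> G w0 <= G w -> box T w.2.
  move=> Kw hw; apply: sqn_box => //; rewrite (@le_trans _ _ T) //; last first.
    by rewrite expr2 ler_peMr.
  have h := hG w Kw.
  have : sqn w.2 <= `|C - G w0| / eps.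
    rewrite ler_pdivlMr // mulrC (@le_trans _ _ (C - G w0)) ?ler_norm //; lra.
  rewrite /T; lra.
have [||w Kw hw] := @compact_EVT_max _ _ G (K `*` box T) _ (compact_setX cK (compact_box (T := T))).
- by exists w0; split => //=; apply: (inb w0).
- exact: continuous_subspaceT.
have Kw0 : (w0 \in K `*` box T) by rewrite inE; split => //=; exact: (inb w0).
exists w; first by move: Kw; rewrite inE => -[].
move=> w' Kw'; have [h|h] := leP (G w0) (G w').
  by apply: hw; rewrite inE; split=> //; exact: inb.
by rewrite (le_trans (ltW h)) // hw.
Qed.

End Maxima.

Section Operator.
Context {R : realType} {N : nat} (A : R -> 'M[R]_N) (q : R -> 'rV[R]_N).
Implicit Types (z : R * 'rV[R]_N) (g h : R * 'rV[R]_N -> R).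

(** The function [g_t - tr (A D^2 g) - q . D g] takes the value [k] at [z]. This
    relation is linear in [(g, k)], so that barrier computations add up without
    naming Hessians. *)
Definition parab g z (k : R) := exists tau p H,
  jet g z tau p H /\ k = tau - frob (A z.1) H - dot (q z.1) p.

Lemma parabD g h z k l : parab g z k -> parab h z l -> parab (g + h) z (k + l).
Proof.
move=> [t [p [H [J ->]]]] [t' [p' [H' [J' ->]]]].
exists (t + t'), (p + p'), (H + H'); split; first exact: jetD.
rewrite frobDr dotDr; ring.
Qed.

Lemma parabZ c g z k : parab g z k -> parab (c *: g) z (c * k).
Proof.
move=> [t [p [H [J ->]]]].
exists (c * t), (c *: p), (c *: H); split; first exact: jetZ.
rewrite frobZr dotZr; ring.
Qed.

Lemma parabB g h z k l : parab g z k -> parab h z l -> parab (g - h) z (k - l).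
Proof.
by move=> G H; have := parabD G (parabZ (-1) H); rewrite scaleN1r mulN1r.
Qed.

Lemma parab_shift g z k y : parab g (z.1, z.2 + y) k ->
  parab (fun z => g (z.1, z.2 + y)) z k.
Proof.
by move=> [t [p [H [J ->]]]]; exists t, p, H; split => //; exact: jet_shift.
Qed.

Lemma parab_max g z k : psd (A z.1) -> parab g z k ->
  (\forall z' \near z, z'.1 <= z.1 -> g z' <= g z) -> 0 <= k.
Proof.
move=> pA [t [p [H [J ->]]]] mx; have [t0 -> nH] := jet_max J mx.
case: J => _ _ sH; have := frob_le0 pA sH nH.
rewrite dotC dot0l; lra.
Qed.

Lemma jet_sqn z : jet sqn z (2 * z.1) (2 *: z.2) (2 *: 1%:M).
Proof.
have J := jetD (jetM (jet_time z) (jet_time z)) (jet_sqr_dist 0 z).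
have -> : sqn = ((fun z => z.1) * (fun z => z.1) +
   (fun z => dot (z.2 - 0) (z.2 - 0)) : R * 'rV[R]_N -> R).
  apply/funext => y; transitivity (y.1 * y.1 + dot (y.2 - 0) (y.2 - 0)) => //.
  by rewrite /sqn expr2 !subr0.
move: J; rewrite !scaler0 !add0r !addr0 !subr0 trmx0 mul0mx !add0r mulr1.
by rewrite mulr2n mulrDl mul1r.
Qed.

Lemma parab_sqn z : parab sqn z (2 * z.1 - 2 * \tr (A z.1) - 2 * dot (q z.1) z.2).
Proof.
exists (2 * z.1), (2 *: z.2), (2 *: 1%:M); split; first exact: jet_sqn.
by rewrite frobZr frob1 dotZr.
Qed.

Lemma parab_exp (k l c : R) (e : 'rV[R]_N) z :
  parab (fun z => expR (k * (dot z.2 e + l * z.1 + c))) z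
   (expR (k * (dot z.2 e + l * z.1 + c)) *
      (k * l - k ^+ 2 * quad (A z.1) e - k * dot (q z.1) e)).
Proof.
set E := expR _.
exists (E * (k * l)), (E *: (k *: e)), (E *: ((k *: e)^T *m (k *: e))); split; last first.
  rewrite frobZr frob_outer quadZv !dotZr; ring.
have := jet_exp (jetZ k (jetD (jetD (jet_dot e z) (jetZ l (jet_time z))) (jet_cst c z))).
by rewrite !scaler0 !addr0 !add0r mulr1 scaler0 add0r.
Qed.

End Operator.

Lemma small_penalty_weight (R : realType) (C Q S D : R) : 0 < C -> 0 < Q -> 0 <= S -> 0 < D ->
  exists gam : R, [/\ 0 < gam <= 1, gam * C < Q & gam ^+ 2 * S <= D].
Proof.
move=> C0 Q0 S0 D0.
pose T := 1 + C / Q + S / D + 1.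
have h1 : 0 < C / Q by rewrite divr_gt0.
have h2 : 0 <= S / D by rewrite divr_ge0 // ltW.
have T0 : 0 < T by rewrite /T; lra.
have iT0 : 0 < T^-1 by rewrite invr_gt0.
have iT1 : T^-1 <= 1 by rewrite invf_le1 // /T; lra.
exists T^-1; split; first by rewrite iT0.
  rewrite ltr_pdivrMl // mulrC -ltr_pdivrMl // mulrC /T; lra.
have h : T^-1 * S <= D.
  rewrite ler_pdivrMl // mulrC -ler_pdivrMl // mulrC /T; lra.
apply: le_trans h; rewrite expr2 -mulrA ler_piMl // mulr_ge0 // ltW //.
Qed.

(** When [gamma] tends to 0, the penalization [gamma ^+ 2 * sqn] contributes
    arbitrarily little at points where it stays bounded, although its gradient
    is unbounded. *)
Lemma penalty_small (R : realType) (N : nat) (gamma C Ca Cq tr : R)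
    (b : 'rV[R]_N) (z : R * 'rV[R]_N) :
  0 < gamma <= 1 -> 0 <= Ca -> tr <= Ca -> dot b b <= Cq ->
  gamma ^+ 2 * sqn z <= C ->
  gamma ^+ 2 * (2 * tr + 2 * dot b z.2 - 2 * z.1) <= gamma * (2 * Ca + Cq + 1 + C).
Proof.
move=> /andP[g0 g1] Ca0 trC bC h.
have h1 : 2 * dot b (gamma *: z.2) <= dot b b + gamma ^+ 2 * dot z.2 z.2.
  have := dot_ge0 (b - gamma *: z.2).
  rewrite !(dotDl, dotDr, dotNl, dotNr, dotZl, dotZr) (dotC _ b); nra.
rewrite dotZr in h1.
have h2 : - (2 * (gamma * z.1)) <= 1 + gamma ^+ 2 * z.1 ^+ 2.
  have := sqr_ge0 (1 + gamma * z.1); nra.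
have h3 : gamma * (2 * tr) <= 2 * Ca.
  have : gamma * tr <= gamma * Ca by rewrite ler_wpM2l // ltW.
  have : gamma * Ca <= 1 * Ca by rewrite ler_wpM2r.
  lra.
rewrite expr2 -mulrA ler_pM2l //.
move: h; rewrite /sqn mulrDr; lra.
Qed.

(** * Lipschitz continuity in space *)

Definition coef_bounds (R : realType) (N : nat) (A : R -> 'M[R]_N)
    (q : R -> 'rV[R]_N) (al Ca Cq : R) : Prop :=
  [/\ 0 < al, 0 <= Ca, 0 <= Cq & forall t,
    [/\ forall v, al * dot v v <= quad (A t) v, \tr (A t) <= Ca &
        dot (q t) (q t) <= Cq]].

Lemma coef_psd (R : realType) (N : nat) (A : R -> 'M[R]_N) (q : R -> 'rV[R]_N)
  al Ca Cq t : coef_bounds A q al Ca Cq -> psd (A t).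
Proof.
move=> [a0 _ _ /(_ t)[h _ _]] v; apply: le_trans (h v).
by rewrite mulr_ge0 ?dot_ge0 // ltW.
Qed.

Section Lipschitz.
Context {R : realType} {N : nat} (A : R -> 'M[R]_N) (q : R -> 'rV[R]_N).
Variables (al Ca Cq B F : R) (u : R * 'rV[R]_N -> R).
Hypothesis coefs : coef_bounds A q al Ca Cq.
Hypothesis cu : continuous u.
Hypothesis ubound : forall z, `|u z| <= B.
Hypothesis ueq : forall z, exists2 k, parab A q u z k & `|k| <= F.

(** The slope at 0 of the barrier [K0 * (2 * s - s ^+ 2)], up to a factor 2. The
    term [2 * B] dominates the difference at [s = 1]; the term [(F + 1) / al]
    makes the concavity of the barrier absorb the right-hand side. *)
Let K0 := 2 * B + (F + 1) / al.

Lemma doubled_continuous (v : 'rV[R]_N) : continuous (fun w : R * (R * 'rV[R]_N) =>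
  u (w.2.1, w.2.2 + w.1 *: v) - u (w.2.1, w.2.2 + (- w.1) *: v)
   - K0 * (2 * w.1 - w.1 ^+ 2)).
Proof.
have c1 : continuous (fun w : R * (R * 'rV[R]_N) => w.1) by move=> w; exact: cvg_fst.
have c2 : continuous (fun w : R * (R * 'rV[R]_N) => w.2) by move=> w; exact: cvg_snd.
have cs (sg : R) : continuous (fun w : R * (R * 'rV[R]_N) =>
    u (w.2.1, w.2.2 + (sg * w.1) *: v)).
  apply: (@continuous_composite _ _ _
    (fun w : R * (R * 'rV[R]_N) => (w.2.1, w.2.2 + (sg * w.1) *: v)) u _ cu).
  apply: continuous_pair; first exact: continuous_composite c2 (@continuous_time R N).
  move=> w; apply: cvgD; first exact: (continuous_composite c2 (@continuous_space R N)).
  by apply: cvgZr_tmp; apply: cvgM; [exact: cvg_cst|exact: c1].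
have -> : (fun w : R * (R * 'rV[R]_N) =>
  u (w.2.1, w.2.2 + w.1 *: v) - u (w.2.1, w.2.2 + (- w.1) *: v)
   - K0 * (2 * w.1 - w.1 ^+ 2)) = (fun w : R * (R * 'rV[R]_N) =>
  u (w.2.1, w.2.2 + (1 * w.1) *: v) - u (w.2.1, w.2.2 + (-1 * w.1) *: v)
   - K0 * (2 * w.1 - w.1 * w.1)).
  by apply/funext => w; rewrite mul1r mulN1r expr2.
move=> w; apply: cvgB; first by apply: cvgB; exact: cs.
apply: cvgM; first exact: cvg_cst.
apply: cvgB; first by apply: cvgM; [exact: cvg_cst|exact: c1].
by apply: cvgM; exact: c1.
Qed.

(** Since [A] and [q] do not depend on [x], the symmetric difference
    [u (t, x + s v) - u (t, x - s v)] solves the equation, up to bounded terms,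
    in the variables [(t, x)]; its second derivatives in [s] and in the
    direction [v] coincide, so that part of the diffusion can be moved to the
    variable [s], where a concave function is a strict supersolution. *)
Lemma symmetric_difference_le t x (v : 'rV[R]_N) s :
  dot v v <= 1 -> 0 <= s <= 1 ->
  u (t, x + s *: v) - u (t, x - s *: v) <= K0 * (2 * s - s ^+ 2).
Proof.
move=> v1 s01; rewrite leNgt; apply/negP => lt0.
have [al0 Ca0 Cq0 hc] := coefs.
pose D (w : R * (R * 'rV[R]_N)) :=
  u (w.2.1, w.2.2 + w.1 *: v) - u (w.2.1, w.2.2 + (- w.1) *: v)
   - K0 * (2 * w.1 - w.1 ^+ 2).
pose w0 : R * (R * 'rV[R]_N) := (s, (t, x)).
have D0 : 0 < D w0 by rewrite /D /w0 /= scaleNr subr_gt0.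
have B0 : 0 <= B by exact: le_trans (ubound (0, 0)).
have F0 : 0 <= F by have [k _] := ueq (0, 0); exact: le_trans.
have K00 : 0 <= K0 by rewrite /K0 addr_ge0 ?divr_ge0 ?mulr_ge0 ?addr_ge0 // ltW.
have bd z z' : u z - u z' <= 2 * B.
  have := ubound z; have := ubound z'; rewrite !ler_norml; lra.
have Dle w : `[0, 1]%classic w.1 -> D w <= 2 * B.
  rewrite /= in_itv /= => /andP[h1 h2]; rewrite /D.
  have := bd (w.2.1, w.2.2 + w.1 *: v) (w.2.1, w.2.2 + (- w.1) *: v).
  have : 0 <= K0 * (2 * w.1 - w.1 ^+ 2) by rewrite mulr_ge0 //; nra.
  lra.
(* The constant of [penalty_small], the penalty being at most [2 * B]. *)
pose C1 := 2 * Ca + Cq + 1 + 2 * B.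
have C10 : 0 < C1 by rewrite /C1; lra.
have [gam [/andP[g0 g1] gC gD']] : exists gam : R, [/\ 0 < gam <= 1, gam * C1 < 1 &
    gam ^+ 2 * sqn w0.2 <= D w0 / 2].
  by apply: small_penalty_weight; rewrite ?sqn_ge0 ?divr_gt0.
have gD : gam ^+ 2 * sqn w0.2 < D w0 by lra.
pose G w := D w - gam ^+ 2 * sqn w.2.
have [] := @coercive_max R N R `[0, 1]%classic G (2 * B) (gam ^+ 2).
- by exists s; rewrite /= in_itv.
- exact: segment_compact.
- move=> w; apply: cvgB; first exact: doubled_continuous.
  apply: cvgM; first exact: cvg_cst.
   apply: (cvg_comp snd); last exact: continuous_sqn.
  exact: cvg_snd.
- by rewrite exprn_gt0.
- by move=> w h; rewrite lerD2r Dle.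
move=> [s1 [t1 x1]] /=; rewrite in_itv /= => s1I mx.
have G0 : 0 < G (s1, (t1, x1)).
  apply: lt_le_trans (mx w0 _); first by rewrite subr_gt0.
  by rewrite /= in_itv.
have pen0 : 0 <= gam ^+ 2 * sqn (t1, x1) by rewrite mulr_ge0 ?sqr_ge0 ?sqn_ge0.
have D1 : 0 < D (s1, (t1, x1)) by move: G0; rewrite /G /=; lra.
have s1p : 0 < s1.
  rewrite lt_def (andP s1I).1 andbT; apply/negP => /eqP s10.
  by move: D1; rewrite /D s10 /= oppr0 scale0r addr0 subrr expr0n /= mulr0 subrr mulr0 subrr ltxx.
have s1l : s1 < 1.
  rewrite lt_def (andP s1I).2 andbT; apply/negP => /eqP s10.
  move: D1; rewrite /D -s10 /= expr1n.
  have := bd (t1, x1 + 1 *: v) (t1, x1 + (-1) *: v).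
  have : 2 * B <= K0 * (2 * 1 - 1).
    by rewrite mulr1 -[2 - 1]/(1 + 1 - 1) addrK mulr1 lerDl divr_ge0 ?addr_ge0 // ltW.
  lra.
have penC : gam ^+ 2 * sqn (t1, x1) <= 2 * B.
  have : D (s1, (t1, x1)) <= 2 * B by apply: Dle; rewrite /= in_itv.
  move: G0; rewrite /G /=; lra.
have [hal htr hqq] := hc t1.
have [k [ta [p [H [J ek]]]] kF] := ueq (t1, x1 + s1 *: v).
have [k' [ta' [p' [H' [J' ek']]]] kF'] := ueq (t1, x1 + (- s1) *: v).
pose g (z : R * 'rV[R]_N) := u (z.1, z.2 + s1 *: v) - u (z.1, z.2 + (- s1) *: v) - gam ^+ 2 * sqn z.
have Jg : jet g (t1, x1) (ta - ta' - gam ^+ 2 * (2 * t1))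
    (p - p' - gam ^+ 2 *: (2 *: x1)) (H - H' - gam ^+ 2 *: (2 *: 1%:M)).
  apply: jetB; first by apply: jetB; exact: jet_shift.
  by apply: jetZ; exact: jet_sqn.
have mg z : g z <= g (t1, x1).
  have := mx (s1, z); rewrite /= in_itv /= => /(_ s1I).
  rewrite /G /D /g /=; lra.
have mg' : \forall z' \near (t1, x1), z'.1 <= t1 -> g z' <= g (t1, x1).
  by apply: (@nearW _ (nbhs (t1, x1))) => z' _; exact: mg.
have [ge0 p0 nH] := jet_max Jg mg'.
(* Second derivative in [s]: along [v] at one point, along [- v] at the other;
   [- 2 * K0] is that of the barrier. *)
have ss : quad H v - quad H' v + 2 * K0 <= 0.
  case: J => _ /(_ v) e _; case: J' => _ /(_ (- v)) e' _.
  have qN : quad H' (- v) = quad H' v.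
    by apply: eq_bigr => i _; apply: eq_bigr => j _; rewrite !mxE !mulrN mulNr opprK.
  rewrite qN in e'.
  have id2 : derive2_at0 (fun r : R => r) 1 0.
    by apply: derive2_at0_ext (derive2_at0_affine 0 1) => r; rewrite add0r mulr1.
  have ep := derive2_at0D (derive2_at0_affine (- (K0 * (2 * s1 - s1 ^+ 2))) (- (K0 * (2 - 2 * s1))))
    (derive2_at0Z K0 (derive2_at0M id2 id2)).
  have ed := derive2_at0D (derive2_at0D e (derive2_at0Z (-1) e')) ep.
  have [|_] := derive2_at0_max ed; last lra.
  have [d [d0 d1 d2]] : exists d : R, [/\ 0 < d, d <= s1 & d <= 1 - s1].
    exists (Num.min s1 (1 - s1)); rewrite lt_min !ge_min !lexx orbT s1p; split => //.
    by rewrite subr_gt0.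
  exists d => // r; rewrite ltr_norml => rd.
  pose ph r := u (t1, x1 + (s1 + r) *: v) - u (t1, x1 + (- (s1 + r)) *: v)
    - K0 * (2 * (s1 + r) - (s1 + r) ^+ 2).
  have E y : (((fun r0 => u (t1, x1 + s1 *: v + r0 *: v)) +
     (-1) *: (fun r0 => u (t1, x1 + (- s1) *: v + r0 *: - v))) +
     ((fun r0 => - (K0 * (2 * s1 - s1 ^+ 2)) + r0 * - (K0 * (2 - 2 * s1))) +
     K0 *: ((fun r => r) * (fun r => r)))) y = ph y.
    transitivity (u (t1, x1 + s1 *: v + y *: v) + (-1) * u (t1, x1 + (- s1) *: v + y *: - v)
      + (- (K0 * (2 * s1 - s1 ^+ 2)) + y * - (K0 * (2 - 2 * s1)) + K0 * (y * y))) => //.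
    have e1 : x1 + s1 *: v + y *: v = x1 + (s1 + y) *: v by rewrite -addrA -scalerDl.
    have e2 : x1 + (- s1) *: v + y *: - v = x1 + (- (s1 + y)) *: v.
      by rewrite scalerN -scaleNr -addrA -scalerDl opprD.
    rewrite e1 e2 /ph; move: (u _) (u _) => a b; ring.
  rewrite !E /ph addr0.
  have mr := mx (s1 + r, (t1, x1)); rewrite /= in_itv /= in mr.
  have {mr} := mr ltac:(lra).
  rewrite /G /D /=; set a := u _; set b := u _; set a' := u _; set b' := u _; lra.
(* What remains of the diffusion once [al v^T v] is moved to the variable [s]. *)
have pM : psd (A t1 - al *: (v^T *m v)).
  move=> y; rewrite quadD -scaleNr quadZ quad_outer -expr2.
  have := hal y; have := dot_CS v y; have := dot_ge0 y; have := dot_ge0 v.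
  move=> h1 h2 h3 h4.
  have : al * dot v y ^+ 2 <= al * dot y y.
    rewrite ler_pM2l //; apply: le_trans h3 _; by rewrite ler_piMl.
  lra.
have := frob_le0 pM _ nH; have [_ _ sH] := Jg => /(_ sH).
rewrite frob_sub_outer.
have pp : dot (q t1) p - dot (q t1) p' = gam ^+ 2 * (2 * dot (q t1) x1).
  rewrite -dotNr -dotDr -!dotZr; congr dot.
  by apply/eqP; rewrite -subr_eq0; apply/eqP.
rewrite !(quadB, frobBr) !(quadZ, frobZr) quad1 frob1.
have := @penalty_small R N gam (2 * B) Ca Cq (\tr (A t1)) (q t1) (t1, x1) _ Ca0 htr hqq penC.
rewrite g0 g1 => /(_ isT) /= pen.
have aK : al * K0 = 2 * B * al + (F + 1).
  by rewrite /K0; field; exact: lt0r_neq0.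
have sal := ss; rewrite -(ler_pM2l al0) mulr0 in sal.
have v0 : 0 <= al * (gam ^+ 2 * dot v v) by rewrite !mulr_ge0 ?dot_ge0 ?sqr_ge0 // ltW.
have Ba : 0 <= 2 * B * al by rewrite !mulr_ge0 // ltW.
rewrite /= in ek ek'; rewrite /C1 in gC.
move: kF kF'; rewrite !ler_norml => /andP[_ kF] /andP[kF' _].
move: pp ge0 ek ek' kF kF' pen aK sal v0 Ba gC.
move: (dot (q t1) p) (dot (q t1) p') (dot (q t1) x1) (frob (A t1) H) (frob (A t1) H').
move: (quad H v) (quad H' v) (\tr (A t1)) => *; lra.
Qed.

Lemma lipschitz_space t x y rho : 0 < rho -> dot (x - y) (x - y) <= rho ^+ 2 ->
  u (t, x) - u (t, y) <= K0 * rho.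
Proof.
move=> r0 h.
have B0 : 0 <= B by exact: le_trans (ubound (0, 0)).
have F0 : 0 <= F by have [k _] := ueq (0, 0); exact: le_trans.
have [al0 _ _ _] := coefs.
have KB : 2 * B <= K0 by rewrite lerDl divr_ge0 ?addr_ge0 // ltW.
have [r2|r2] := leP rho 2.
  pose v := rho^-1 *: (x - y); pose c := 2^-1 *: (x + y).
  have v1 : dot v v <= 1.
    by rewrite dotZl dotZr mulrA -expr2 exprVn ler_pdivrMl ?mulr1 ?exprn_gt0.
  have sv : (rho / 2) *: v = 2^-1 *: (x - y).
    by rewrite /v scalerA mulrAC divff ?mul1r // lt0r_neq0.
  have half (w : 'rV[R]_N) : 2^-1 *: w + 2^-1 *: w = w.
    by rewrite -scalerDl (_ : 2^-1 + 2^-1 = 1 :> R) ?scale1r //; field.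
  have := @symmetric_difference_le t c v (rho / 2) v1.
  have -> : c + (rho / 2) *: v = x.
    by rewrite sv /c -scalerDr addrACA subrr addr0 scalerDr half.
  have -> : c - (rho / 2) *: v = y.
    by rewrite sv /c -scalerBr opprB addrC subrKA scalerDr half.
  have -> : 0 <= rho / 2 <= 1 by lra.
  move=> /(_ isT) h1; apply: le_trans h1 _.
  have : 0 <= K0 * (rho / 2) ^+ 2 by rewrite mulr_ge0 ?sqr_ge0 //; lra.
  lra.
have := ubound (t, x); have := ubound (t, y); rewrite !ler_norml.
have K00 : 0 <= K0 by apply: le_trans KB; rewrite mulr_ge0.
have : K0 * 2 <= K0 * rho by rewrite ler_wpM2l ?(ltW r2).
move: (u _) (u _) => *; lra.
Qed.

End Lipschitz.

(** * Regularizing the position of the front *)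

Section LipschitzFront.
Context {R : realType} (xi : R -> R) (sigma C : R).
Hypothesis sigma0 : 0 < sigma.
Hypothesis jump : forall t s, `|t - s| <= sigma -> `|xi t - xi s| <= C.

Lemma front_jumps n t s : `|t - s| <= n%:R * sigma -> `|xi t - xi s| <= n%:R * C.
Proof.
elim: n t s => [|n IH] t s h.
  by move: h; rewrite mul0r normr_le0 subr_eq0 => /eqP ->; rewrite subrr normr0 mul0r.
pose r := s + (t - s) * (n%:R / n.+1%:R).
have n1 : 0 < n.+1%:R :> R by rewrite ltr0n.
have e : n.+1%:R = n%:R + 1 :> R by rewrite -natr1.
have h1 : `|t - r| <= sigma.
  have -> : t - r = (t - s) / n.+1%:R by rewrite /r; field; rewrite e in n1 *; lra.
  by rewrite normrM normfV (gtr0_norm n1) ler_pdivrMr // mulrC.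
have h2 : `|r - s| <= n%:R * sigma.
  have -> : r - s = n%:R * ((t - s) / n.+1%:R) by rewrite /r; field; rewrite e in n1 *; lra.
  rewrite normrM ger0_norm // ler_wpM2l //.
  by rewrite normrM normfV (gtr0_norm n1) ler_pdivrMr // mulrC.
have := ler_distD (xi r) (xi t) (xi s); have := jump h1; have := IH _ _ h2.
rewrite e; lra.
Qed.

Lemma front_growth t s : `|xi t - xi s| <= C / sigma * `|t - s| + C.
Proof.
have C0 : 0 <= C by have := @jump 0 0; rewrite !subrr !normr0 ltW // => /(_ isT).
pose y := `|t - s| / sigma.
have y0 : 0 <= y by rewrite divr_ge0 // ltW.
have /andP[h1 h2] := truncn_itv y0.
have h : `|t - s| <= (Num.truncn y).+1%:R * sigma by rewrite -ler_pdivrMr // ltW.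
apply: le_trans (front_jumps h) _.
have -> : C / sigma * `|t - s| + C = (y + 1) * C by rewrite /y; field; exact: lt0r_neq0.
by rewrite ler_wpM2r // -natr1 lerD2r.
Qed.

(** The sup-convolution of [xi] with a cone of slope [C / sigma]. It stays within
    [C] of [xi] because, by [front_growth], the increments of [xi] exceed this
    slope by [C] at most. *)
Lemma lipschitz_front : exists eta : R -> R, exists2 L,
  (forall s t, `|eta s - eta t| <= L * `|s - t|) & forall t, `|eta t - xi t| <= C.
Proof.
have C0 : 0 <= C by have := @jump 0 0; rewrite !subrr !normr0 ltW // => /(_ isT).
pose L := C / sigma.
have L0 : 0 <= L by rewrite divr_ge0 // ltW.
pose E t := [set xi s - L * `|t - s| | s in [set: R]].
have ub t : ubound (E t) (xi t + C).
  move=> _ [s _ <-]; have := front_growth t s; rewrite -/L ler_norml; lra.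
have hub t : has_ubound (E t) by exists (xi t + C); exact: ub.
have mem t s : xi s - L * `|t - s| <= sup (E t) by apply: ub_le_sup => //; exists s.
have ne t : E t !=set0 by exists (xi t - L * `|t - t|), t.
have half t s : sup (E t) <= sup (E s) + L * `|s - t|.
  apply: ge_sup; first exact: ne.
  move=> _ [r _ <-]; have := mem s r.
  have : L * `|s - r| <= L * (`|s - t| + `|t - r|) by rewrite ler_wpM2l // ler_distD.
  rewrite mulrDr; lra.
exists (fun t => sup (E t)), L.
  move=> s t; rewrite ler_norml; have := half s t; have := half t s.
  rewrite (distrC t s); lra.
move=> t; have h1 : sup (E t) <= xi t + C by apply: ge_sup; [exact: ne|exact: ub].
have := mem t t; rewrite subrr normr0 mulr0 subr0 ler_norml; lra.
Qed.

End LipschitzFront.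

(** * A maximum principle around a moving hyperplane *)

Section InterfaceMaximumPrinciple.
Context {R : realType} {N : nat} (A : R -> 'M[R]_N) (q : R -> 'rV[R]_N).
Variables (al Ca Cq L B : R) (e : 'rV[R]_N) (eta : R -> R).
Hypothesis coefs : coef_bounds A q al Ca Cq.
Hypothesis e1 : dot e e = 1.
Hypothesis eta_lip : forall s t, `|eta s - eta t| <= L * `|s - t|.
Variable W : R * 'rV[R]_N -> R.
Hypothesis cW : continuous W.
Hypothesis boundW : forall z, W z <= B.
Hypothesis decayW : forall eps : R, 0 < eps -> exists M : R,
  forall z, M <= `|dot z.2 e - eta z.1| -> W z <= eps.
Hypothesis subW : forall z, 0 < W z -> exists2 k, parab A q W z k & k <= 0.

Lemma continuous_front : continuous (fun z : R * 'rV[R]_N => dot z.2 e - eta z.1).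
Proof.
have L0 : 0 <= L.
  have := eta_lip 1 0; rewrite subr0 normr1 mulr1; exact: le_trans.
have ce : continuous eta.
  move=> t; apply/cvgrPdist_le => ep ep0.
  apply/nbhs_ballP; exists (ep / (L + 1)); first by rewrite /= divr_gt0 // ltr_wpDl.
  move=> s; rewrite /ball /= ltr_pdivlMr ?ltr_wpDl // => h.
  apply: le_trans (eta_lip t s) _; apply: le_trans (ltW h).
  by rewrite mulrC ler_wpM2l // lerDl.
move=> z; apply: cvgB; last exact: (continuous_composite (@continuous_time R N) ce).
have cc : continuous (fun _ : R * 'rV[R]_N => e) by move=> ?; exact: cvg_cst.
exact: (continuous_dot (@continuous_space R N) cc).
Qed.

(** Far from the moving hyperplane [x . e = eta t] the function is nearly
    nonpositive. In a strip around it, adding a small multiple of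
    [exp (k (x . e - eta t))] makes the function a strict subsolution as soon as
    [k] is large compared with the drift and the speed of the hyperplane; this
    forbids a positive maximum. *)
Lemma interface_maximum_principle z : W z <= 0.
Proof.
rewrite leNgt; apply/negP => m0; set z0 := z in m0; set m := W z0 in m0.
have [al0 Ca0 Cq0 hc] := coefs.
have L0 : 0 <= L.
  have := eta_lip 1 0; rewrite subr0 normr1 mulr1; exact: le_trans.
have [M hM] := decayW (eps := m / 4) ltac:(lra).
(* [L] bounds the speed of the hyperplane and [Cq + 1] the drift along [e]. *)
pose k := (L + Cq + 2) / al.
have alk : k * al = L + Cq + 2 by rewrite /k divfK // lt0r_neq0.
have k0 : 0 < k by rewrite /k divr_gt0 //; lra.
(* With this weight the barrier, truncated at [M], is at most [m / 4]. *)
pose kap := m / 4 * expR (- (k * M)).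
have kap0 : 0 < kap by rewrite mulr_gt0 ?expR_gt0 //; lra.
pose fr (z : R * 'rV[R]_N) := dot z.2 e - eta z.1.
pose b z := kap * expR (k * Num.min (fr z) M).
have b0 z' : 0 < b z' by rewrite mulr_gt0 ?expR_gt0.
have bm z' : b z' <= m / 4.
  rewrite /b /kap -mulrA -expRD -[leRHS]mulr1 ler_wpM2l //; first lra.
  rewrite -expR0 ler_expR addrC subr_le0 ler_wpM2l ?(ltW k0) //.
  by rewrite ge_min lexx orbT.
pose C1 := B + m.
have C10 : 0 <= C1 by have := boundW z0; rewrite -/m /C1; lra.
(* Lower bound in the strip for the strictness gained from the barrier. *)
pose Q := kap * k * expR (- (k * M)).
have Q0 : 0 < Q by apply: mulr_gt0 (mulr_gt0 kap0 k0) (expR_gt0 _).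
pose C2 := 2 * Ca + Cq + 1 + C1.
have C20 : 0 < C2 by rewrite /C2; lra.
have [gam [/andP[g0 g1] gC gD]] : exists gam : R, [/\ 0 < gam <= 1, gam * C2 < Q &
    gam ^+ 2 * sqn z0 <= m / 4].
  by apply: small_penalty_weight; rewrite ?sqn_ge0 ?divr_gt0.
pose G (w : R * (R * 'rV[R]_N)) := W w.2 + b w.2 - gam ^+ 2 * sqn w.2.
have cfr : continuous fr by exact: continuous_front.
have [] := @coercive_max R N R [set 0] G (B + m / 4) (gam ^+ 2).
- by exists 0.
- exact: compact_set1.
- have c2 : continuous (fun w : R * (R * 'rV[R]_N) => w.2) by move=> w; exact: cvg_snd.
  move=> w; apply: cvgB; last first.
    apply: cvgM; first exact: cvg_cst.
    exact: (continuous_composite c2 (@continuous_sqn R N)).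
  apply: cvgD; first exact: (continuous_composite c2 cW).
  apply: cvgM; first exact: cvg_cst.
  have cm : continuous (fun z => k * Num.min (fr z) M).
    move=> y; apply: cvgM; first exact: cvg_cst.
    apply: (@continuous_min R _ fr (cst M)); first exact: cfr.
    exact: cvg_cst.
  exact: (continuous_composite c2 (continuous_composite cm (@continuous_expR R))).
- by rewrite exprn_gt0.
- by move=> w _; rewrite lerD2r lerD.
move=> [s [t1 x1]] /= _ mx0.
have mx z' : G (0, z') <= G (0, (t1, x1)) by exact: (mx0 (0, z')).
have G0 : 3 / 4 * m < G (0, (t1, x1)).
  apply: lt_le_trans (mx z0); rewrite /G /= -/m.
  have := b0 z0; lra.
have W1 : m / 2 < W (t1, x1).
  have := bm (t1, x1); have : 0 <= gam ^+ 2 * sqn (t1, x1).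
    by rewrite mulr_ge0 ?sqr_ge0 ?sqn_ge0.
  move: G0; rewrite /G /=; lra.
have frM : fr (t1, x1) < M.
  rewrite ltNge; apply/negP => h.
  have : W (t1, x1) <= m / 4 by apply: hM; exact: le_trans h (ler_norm _).
  lra.
have penC : gam ^+ 2 * sqn (t1, x1) <= C1.
  have := bm (t1, x1); have := boundW (t1, x1); move: G0; rewrite /G /C1 /=; lra.
have [kW pW kW0] : exists2 k, parab A q W (t1, x1) k & k <= 0 by apply: subW; lra.
(* A smooth function touching [fr] from below, at past times, at the maximum
   point: [eta] itself need not be differentiable. *)
pose ell (z : R * 'rV[R]_N) := dot z.2 e + L * z.1 + (- eta t1 - L * t1).
pose g := W + kap *: (fun z : R * 'rV[R]_N => expR (k * ell z)) - gam ^+ 2 *: @sqn R N.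
have Pg := parabB (parabD pW (parabZ kap (parab_exp A q k L (- eta t1 - L * t1) e (t1, x1))))
   (parabZ (gam ^+ 2) (parab_sqn A q (t1, x1))).
have ell1 : ell (t1, x1) = fr (t1, x1) by rewrite /ell /fr /=; ring.
have mg : \forall z' \near (t1, x1), z'.1 <= t1 -> g z' <= g (t1, x1).
  have cell : continuous ell.
    move=> z'; apply: cvgD; last exact: cvg_cst.
    apply: cvgD; last by apply: cvgM; [exact: cvg_cst|exact: continuous_time].
    apply: (continuous_dot (@continuous_space R N)) => ?; exact: cvg_cst.
  have : \forall z' \near (t1, x1), ell z' < M.
    by move/cvgr_lt: (cell (t1, x1)); apply; rewrite ell1.
  apply: filterS => z' lz zt.
  have -> : g z' = W z' + kap * expR (k * ell z') - gam ^+ 2 * sqn z' by [].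
  have -> : g (t1, x1) = G (0, (t1, x1)).
    rewrite /G /b /= min_l; last exact: ltW.
    by rewrite -ell1.
  apply: le_trans (mx z'); rewrite /G /= lerD2r lerD2l ler_wpM2l ?(ltW kap0) //.
  rewrite ler_expR ler_wpM2l ?(ltW k0) // le_min (ltW lz) andbT.
  have zt0 : z'.1 - t1 <= 0 by rewrite subr_le0.
  have := eta_lip z'.1 t1; rewrite (ler0_norm zt0).
  rewrite ler_norml /ell /fr => /andP[_]; lra.
have := parab_max (coef_psd _ coefs) Pg mg.
have [hal htr hqq] := hc t1; rewrite -/(ell (t1, x1)) ell1 /=.
have := @penalty_small R N gam C1 Ca Cq (\tr (A t1)) (q t1) (t1, x1) _ Ca0 htr hqq penC.
rewrite g0 g1 -/C2 => /(_ isT) /= pen.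
have E0 : expR (- (k * M)) <= expR (k * fr (t1, x1)).
  rewrite ler_expR -mulrN ler_wpM2l ?(ltW k0) //.
  have : - M < fr (t1, x1).
    rewrite ltNge; apply/negP => h.
    have : W (t1, x1) <= m / 4.
      apply: hM; rewrite -normrN; apply: le_trans (ler_norm _).
      move: h; rewrite /fr /=; lra.
    lra.
  lra.
have he := hal e; rewrite e1 mulr1 in he.
have hqe : - dot (q t1) e <= Cq + 1.
  have := dot_ge0 (q t1 + e); rewrite !(dotDl, dotDr) (dotC e) e1; lra.
set E := expR (k * _) in E0 *.
have E00 : 0 < E by exact: expR_gt0.
have neg : k * L - k ^+ 2 * quad (A t1) e - k * dot (q t1) e <= - k.
  have : k * (k * quad (A t1) e) >= k * (k * al) by rewrite !ler_wpM2l // ltW.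
  rewrite alk; have : k * - dot (q t1) e <= k * (Cq + 1) by rewrite ler_wpM2l // ltW.
  rewrite expr2; lra.
have : kap * (E * (k * L - k ^+ 2 * quad (A t1) e - k * dot (q t1) e)) <= - Q.
  apply: (@le_trans _ _ (kap * (E * - k))).
    by rewrite !ler_wpM2l // ltW.
  have h : kap * (k * expR (- (k * M))) <= kap * (k * E).
    by apply: ler_wpM2l; [exact: ltW|apply: ler_wpM2l; [exact: ltW|]].
  rewrite /Q; lra.
move: (kap * _) => X; lra.
Qed.
End InterfaceMaximumPrinciple.

(** * Forward propagation of positivity *)

Section Propagation.
Context {R : realType} {N : nat} (A : R -> 'M[R]_N) (q : R -> 'rV[R]_N).
Variables (al Ca Cq K : R).
Hypothesis coefs : coef_bounds A q al Ca Cq.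
Hypothesis K0 : 0 <= K.

(** The difference of two ordered solutions is of this kind when [K] is a
    Lipschitz constant of [f] in the unknown. *)
Definition supersolution (z : R * 'rV[R]_N -> R) : Prop :=
  [/\ continuous z, forall w, 0 <= z w &
      forall w, exists2 k, parab A q z w k & - (K * z w) <= k].

Definition bump_core (a mu t0 : R) (y : 'rV[R]_N) (w : R * 'rV[R]_N) : R :=
  a + mu * (w.1 - t0) - dot (w.2 - y) (w.2 - y).

Lemma jet_bump_core a mu t0 y w :
  jet (bump_core a mu t0 y) w mu (- (2 *: (w.2 - y))) (- (2 *: 1%:M)).
Proof.
have J := jetB (jetD (jetZ mu (jet_time w)) (jet_cst (a - mu * t0) w)) (jet_sqr_dist y w).
move: J; rewrite !scaler0 !addr0 !sub0r mulr1 subr0.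
suff -> : bump_core a mu t0 y = (mu *: (fun z => z.1) + cst (a - mu * t0) -
   (fun z => dot (z.2 - y) (z.2 - y)) : R * 'rV[R]_N -> R) by [].
apply/funext => z.
transitivity (mu * z.1 + (a - mu * t0) - dot (z.2 - y) (z.2 - y)) => //.
rewrite /bump_core; ring.
Qed.

Definition bump k a mu t0 y (w : R * 'rV[R]_N) : R :=
  expR (- k * (w.1 - t0)) * bump_core a mu t0 y w ^+ 2.

Lemma parab_bump k a mu t0 y w :
  parab A q (bump k a mu t0 y) w
    (expR (- k * (w.1 - t0)) * (- k * bump_core a mu t0 y w ^+ 2
       + 2 * bump_core a mu t0 y w * (mu + 2 * \tr (A w.1) + 2 * dot (q w.1) (w.2 - y))
       - 8 * quad (A w.1) (w.2 - y))).
Proof.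
set P := bump_core a mu t0 y w; set E := expR _.
have J1 : jet (fun w => expR (- k * (w.1 - t0))) w (E * - k) 0 0.
  apply: (@jet_of_time _ _ (fun s => expR (- k * (s - t0)))).
  have h : is_derive w.1 (1 : R) (fun s : R => - k * (s - t0)) (- k).
    apply/is_derive1_epsP => ep ep0; exists 1 => // h _.
    have -> : - k * (w.1 + h - t0) - - k * (w.1 - t0) - h * - k = 0 by ring.
    by rewrite normr0 mulr_ge0 // ltW.
  exact: is_derive1_comp (is_derive_expR _) h.
have J := jetM J1 (jetM (jet_bump_core a mu t0 y w) (jet_bump_core a mu t0 y w)).
have -> : bump k a mu t0 y = (fun w : R * 'rV[R]_N => expR (- k * (w.1 - t0))) *
   (bump_core a mu t0 y * bump_core a mu t0 y) by [].
do 3 eexists; split; first exact: J.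
rewrite (_ : (bump_core a mu t0 y * bump_core a mu t0 y) w = P * P) //.
rewrite -/P -/E !scaler0 !addr0 trmx0 mul0mx mulmx0 !addr0.
set d := w.2 - y.
rewrite !(frobDr, frobZr) !frob_outer -[- (2 *: d)]scaleNr -[- (2 *: 1%:M)]scaleNr.
rewrite !(frobZr, quadZv, dotZr, dotDr) frob1; ring.
Qed.

(** The positive part of the bump is supported in the expanding balls
    [dot d d <= a + mu (t - t0)]. Near the edge of its support the gradient term
    [8 quad A d] dominates, elsewhere the decay in time does. *)
Lemma bump_subsolution (a mu : R) : 0 < a -> 0 <= mu -> exists k : R,
  forall t0 y w, t0 <= w.1 <= t0 + 1 -> 0 < bump_core a mu t0 y w ->
  exists2 l, parab A q (bump k a mu t0 y) w l & l + K * bump k a mu t0 y w < 0.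
Proof.
move=> a0 mu0; have [al0 Ca0 Cq0 hc] := coefs.
pose b := 2 * (2 * mu + 2 * Ca + Cq + a) + 8 * al.
(* The quadratic [m P ^+ 2 - b P + 8 al a] has negative discriminant. *)
pose m := b ^+ 2 / (8 * al * a).
exists (K + m) => t0 y w tw P0; eexists; first exact: parab_bump.
rewrite /bump [K * (_ * _)]mulrCA -mulrDr pmulr_rlt0 ?expR_gt0 //.
set P := bump_core a mu t0 y w in P0 *; set d := w.2 - y.
have [hal htr hqq] := hc w.1.
have hd : dot d d = a + mu * (w.1 - t0) - P by rewrite /P /bump_core -/d; ring.
clearbody P d.
have hmu : 0 <= mu * (w.1 - t0) <= mu.
  by rewrite mulr_ge0 ?ler_piMr //; lra.
have hq : 2 * dot (q w.1) d <= Cq + a + mu.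
  have := dot_ge0 (q w.1 - d).
  rewrite !(dotDl, dotDr, dotNl, dotNr) (dotC d (q w.1)); lra.
have h1 : 2 * P * (mu + 2 * \tr (A w.1) + 2 * dot (q w.1) d) <=
    2 * P * (2 * mu + 2 * Ca + Cq + a).
  by rewrite ler_wpM2l //; lra.
have h2 : al * (a - P) <= quad (A w.1) d.
  by apply: le_trans (hal d); rewrite ler_wpM2l ?(ltW al0) //; lra.
have b0 : 0 < b by rewrite /b; lra.
have ala : 0 < al * a by rewrite mulr_gt0.
have key : 0 < m * P ^+ 2 - b * P + 8 * al * a.
  have e8 : 8 * al * a != 0 by rewrite lt0r_neq0 //; lra.
  have -> : m * P ^+ 2 - b * P + 8 * al * a =
    ((b * P / (8 * al * a) - 1 / 2) ^+ 2 + 3 / 4) * (8 * al * a).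
    by rewrite /m; field; move: e8; rewrite !mulf_eq0 !negb_or => /andP[/andP[_ ->] ->].
  rewrite mulr_gt0 //; last lra.
  have := sqr_ge0 (b * P / (8 * al * a) - 1 / 2); lra.
have : - (K + m) * P ^+ 2 + 2 * P * (2 * mu + 2 * Ca + Cq + a) - 8 * (al * (a - P)) + K * P ^+ 2
   = - (m * P ^+ 2 - b * P + 8 * al * a) by rewrite /b; ring.
lra.
Qed.

Lemma continuous_bump_core a mu t0 y : continuous (bump_core a mu t0 y).
Proof.
have cy : continuous (fun w : R * 'rV[R]_N => w.2 - y).
  by move=> w; apply: cvgB; [exact: continuous_space|exact: cvg_cst].
move=> w; apply: cvgB; last exact: (continuous_dot cy cy).
apply: cvgD; first exact: cvg_cst.
apply: cvgM; first exact: cvg_cst.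
by apply: cvgB; [exact: continuous_time|exact: cvg_cst].
Qed.

(** A bump of initial radius [rho] is put below [z] on the initial ball and
    remains below it. Its squared radius grows at rate [mu = D ^+ 2], so that
    after one unit of time the bump is still at least [expR (- k)] times its
    initial maximum at all points within distance [D] of its center. *)
Lemma propagation (rho D : R) : 0 < rho -> exists2 theta : R, 0 < theta &
  forall z c t (x y : 'rV[R]_N), supersolution z -> 0 < c ->
    (forall x', dot (x' - y) (x' - y) <= rho ^+ 2 -> c <= z (t - 1, x')) ->
    dot (x - y) (x - y) <= D ^+ 2 -> theta * c <= z (t, x).
Proof.
move=> rho0; pose a := rho ^+ 2; pose mu := D ^+ 2.
have a0 : 0 < a by rewrite exprn_gt0.
have mu0 : 0 <= mu by rewrite sqr_ge0.
have [k hk] := bump_subsolution a0 mu0.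
exists (expR (- k)); first exact: expR_gt0.
move=> z c t x y [cz z0 hz] c0 hc hx; rewrite leNgt; apply/negP => neg.
pose t0 := t - 1; pose kap := c / a ^+ 2.
have kap0 : 0 < kap by rewrite divr_gt0 // exprn_gt0.
pose P := bump_core a mu t0 y.
pose G (w : R * 'rV[R]_N) :=
  kap * (expR (- k * (w.1 - t0)) * Num.max (P w) 0 ^+ 2) - z w.
have cG : continuous G.
  have cP : continuous (fun w => Num.max (P w) 0).
    move=> w; apply: (@continuous_max R _ P (cst 0)); first exact: continuous_bump_core.
    exact: cvg_cst.
  have ct : continuous (fun w : R * 'rV[R]_N => - k * (w.1 - t0)).
    move=> w; apply: cvgM; first exact: cvg_cst.
    by apply: cvgB; [exact: continuous_time|exact: cvg_cst].
  move=> w; apply: cvgB; last exact: cz.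
  apply: cvgM; first exact: cvg_cst.
  apply: cvgM; first exact: (continuous_composite ct (@continuous_expR R)).
  under eq_fun do rewrite expr2.
  by rewrite expr2; apply: cvgM; exact: cP.
(* The box of half-width [T] contains the support of the bump at all times. *)
pose T := a + mu + 1.
pose S : set (R * 'rV[R]_N) := `[t0, t] `*`
  [set x' : 'rV[R]_N | forall i : 'I_N, (`[y 0 i - T, y 0 i + T]%classic : set R) (x' ord0 i)].
have cS : compact S.
  apply: compact_setX; first exact: segment_compact.
  apply: (@rV_compact R N (fun i => `[y 0 i - T, y 0 i + T]%classic)) => i.
  exact: segment_compact.
have PS w : t0 <= w.1 <= t -> 0 < P w -> S w.
  move=> tw Pw; split; first by rewrite /= in_itv.
  move=> i; rewrite /= in_itv /= -ler_distlC.
  have : (w.2 - y) 0 i ^+ 2 <= T ^+ 2.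
    apply: le_trans (sqr_coord_le _ i) _.
    have h : mu * (w.1 - t0) <= mu by rewrite ler_piMr //; rewrite /t0 in tw *; lra.
    have h2 : dot (w.2 - y) (w.2 - y) <= T by move: Pw; rewrite /P /bump_core /T; lra.
    apply: le_trans h2 _; rewrite expr2 ler_peMr // /T; lra.
  rewrite !mxE -[X in X <= _]real_normK ?num_real // ler_sqr ?nnegrE //.
    by rewrite distrC.
  by rewrite /T; lra.
have Px : a <= P (t, x) by rewrite /P /bump_core /t0 /=; move: hx; rewrite -/mu; lra.
have Gx : 0 < G (t, x).
  rewrite subr_gt0; apply: lt_le_trans neg _.
  rewrite /= /t0 opprB addrCA subrr addr0 mulr1 mulrCA ler_wpM2l ?expR_ge0 //.
  rewrite /kap -mulrA ler_peMr ?(ltW c0) // mulrC ler_pdivlMr ?exprn_gt0 // mul1r.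
  by rewrite ler_sqr ?nnegrE ?le_max ?lexx ?orbT ?Px // ltW.
have Sx : S (t, x) by apply: PS; rewrite /= /t0; lra.
have [||[t1 x1] wS mx] := @compact_EVT_max _ _ G S _ cS.
- by exists (t, x).
- exact: continuous_subspaceT.
have G1 : 0 < G (t1, x1) by apply: lt_le_trans Gx (mx _ _); rewrite inE.
move: wS; rewrite inE => -[/=]; rewrite in_itv /= => /andP[t1l t1u] _.
have P1 : 0 < P (t1, x1).
  rewrite ltNge; apply/negP => h; move: G1; rewrite /G max_r // expr0n /= !mulr0 sub0r.
  by have := z0 (t1, x1); lra.
have t1t : t0 < t1.
  rewrite lt_def t1l andbT; apply/negP => /eqP e.
  move: G1 P1; rewrite /G /P /bump_core e /= subrr !mulr0 expR0 mul1r addr0 => G1 P1.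
  have h : c <= z (t0, x1) by apply: hc; rewrite -/a; lra.
  move: G1; rewrite max_l ?(ltW P1) // subr_gt0 ltNge => /negP; apply.
  apply: le_trans h; rewrite /kap -mulrA ler_piMr ?(ltW c0) // mulrC ler_pdivrMr ?exprn_gt0 //.
  rewrite mul1r ler_sqr ?nnegrE ?(ltW P1) ?(ltW a0) //.
  have := dot_ge0 (x1 - y); lra.
pose g := kap *: bump k a mu t0 y - z.
have [l pb hl] := hk t0 y (t1, x1) ltac:(by rewrite /= /t0; rewrite /t0 in t1l; lra) P1.
have [kz pz hkz] := hz (t1, x1).
have gG w : 0 < P w -> g w = G w.
  by move=> h; rewrite /G max_l // ltW.
have mg : \forall w \near (t1, x1), w.1 <= t1 -> g w <= g (t1, x1).
  have h1 : \forall w \near (t1, x1), 0 < P w.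
    by move/cvgr_gt: (@continuous_bump_core a mu t0 y (t1, x1)); apply.
  have h2 : \forall w \near (t1, x1), t0 < w.1.
    by move/cvgr_gt: (@continuous_time R N (t1, x1)); apply.
  apply: filterS2 h1 h2 => w Pw tw wt.
  rewrite !gG //; apply: mx; rewrite inE; apply: PS => //.
  by rewrite (ltW tw) (le_trans wt).
have := parab_max (coef_psd _ coefs) (parabB (parabZ kap pb) pz) mg.
have Gz : z (t1, x1) < kap * bump k a mu t0 y (t1, x1).
  by rewrite -subr_gt0; move: G1; rewrite -gG.
have h3 : kap * (l + K * bump k a mu t0 y (t1, x1)) < 0 by rewrite pmulr_rlt0.
have h4 : K * z (t1, x1) <= K * (kap * bump k a mu t0 y (t1, x1)).
  by rewrite ler_wpM2l // ltW.
move: hkz h3 h4; move: (bump _ _ _ _ _ _) (z _) => *; lra.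
Qed.

End Propagation.

(** * Sliding the wave *)

Section StrictPositivity.
Context {R : realType} {N : nat} (A : R -> 'M[R]_N) (q : R -> 'rV[R]_N).
Variables (al Ca Cq K : R).
Hypothesis coefs : coef_bounds A q al Ca Cq.
Hypothesis K0 : 0 <= K.

Lemma positivity_spreads z t (x y : 'rV[R]_N) : supersolution A q K z ->
  0 < z (t - 1, y) -> 0 < z (t, x).
Proof.
move=> sz zy; have [cz _ _] := sz.
pose c := z (t - 1, y) / 2; have c0 : 0 < c by rewrite divr_gt0.
have : \forall w \near (t - 1, y), c < z w.
  by move/cvgr_gt: (cz (t - 1, y)); apply; rewrite /c; lra.
move=> /nbhs_ballP[d /= d0 Hd].
have d2 : 0 < d / 2 by rewrite divr_gt0.
have [th th0 H] := propagation coefs K0 (1 + dot (x - y) (x - y)) d2.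
apply: lt_le_trans (H z c t x y sz c0 _ _); first exact: mulr_gt0.
  move=> x' hx; apply: ltW; apply: Hd; split; first exact: ballxx.
  rewrite /= mx_norm_ball /ball_ /= distrC.
  have := normr_le_dot (ltW d2) hx; lra.
have := dot_ge0 (x - y); nra.
Qed.

End StrictPositivity.

Section Sliding.
Context {R : realType} {N : nat} (A : R -> 'M[R]_N) (q : R -> 'rV[R]_N).
Variables (al Ca Cq B F K L g0 delta : R) (e : 'rV[R]_N).
Variables (f : R -> R -> R -> R) (pm pp : R -> R -> R) (eta : R -> R).
Variable u : R * 'rV[R]_N -> R.
Hypothesis coefs : coef_bounds A q al Ca Cq.
Hypothesis e1 : dot e e = 1.
Hypothesis K0 : 0 <= K.
Hypothesis g00 : 0 < g0.
Hypothesis delta0 : 0 < delta.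
Hypothesis eta_lip : forall s t, `|eta s - eta t| <= L * `|s - t|.
Hypothesis bu : forall z, `|u z| <= B.
Hypothesis bpm : forall z, `|planar e pm z| <= B.
Hypothesis bpp : forall z, `|planar e pp z| <= B.
Hypothesis cu : continuous u.
Hypothesis cpm : continuous (planar e pm).
Hypothesis cpp : continuous (planar e pp).
Hypothesis fbound : forall z s, `|s| <= B -> `|planar e f z s| <= F.
Hypothesis flip : forall z s s', `|s| <= B -> `|s'| <= B ->
  `|planar e f z s - planar e f z s'| <= K * `|s - s'|.
Hypothesis equ : forall z, parab A q u z (planar e f z (u z)).
Hypothesis eqm : forall z, parab A q (planar e pm) z (planar e f z (planar e pm z)).
Hypothesis eqp : forall z, parab A q (planar e pp) z (planar e f z (planar e pp z)).
Hypothesis pm_mono : forall t r r', r <= r' -> pm t r' <= pm t r.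
Hypothesis pp_mono : forall t r r', r <= r' -> pp t r' <= pp t r.
Hypothesis f_mono : forall t s r r', r <= r' -> f t r' s <= f t r s.
Hypothesis f_low : forall z s s', s <= s' -> s' <= planar e pm z + delta ->
  planar e f z s' <= planar e f z s.
Hypothesis f_high : forall z s s', s <= s' -> planar e pp z - delta <= s ->
  planar e f z s' <= planar e f z s.
Hypothesis gap : forall z, planar e pm z + g0 <= planar e pp z.
Hypothesis wave : forall eps : R, 0 < eps -> exists2 M : R, 0 <= M & forall t x,
  (dot x e - eta t <= - M -> `|u (t, x) - pp t (dot x e)| <= eps) /\
  (dot x e - eta t >= M -> `|u (t, x) - pm t (dot x e)| <= eps).

Lemma far_cases M (y : R) : M <= `|y| -> y <= - M \/ M <= y.
Proof. by case: (ger0P y) => h hM; [right|left]; lra. Qed.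

(** Where [u > pp], both values lie in the range in which [f] is nonincreasing
    in the unknown, so that [u - pp] is a subsolution there. *)
Lemma wave_le_pp z : u z <= planar e pp z.
Proof.
have g0p := g00; have dp := delta0.
rewrite -subr_le0.
apply: (@interface_maximum_principle R N A q al Ca Cq L (B + B) e eta coefs e1
  eta_lip (u - planar e pp)).
- by move=> y; apply: cvgB; [exact: cu|exact: cpp].
- move=> y; have := bu y; have := bpp y; rewrite !ler_norml.
  change ((u - planar e pp) y) with (u y - planar e pp y); lra.
- move=> eps eps0; have [M M0 hM] := wave eps0; exists M => -[t x] /far_cases /=.
  change ((u - planar e pp) (t, x)) with (u (t, x) - planar e pp (t, x)).
  have [h1 h2] := hM t x; have := gap (t, x); rewrite /planar /=.
  by move=> g [/h1|/h2]; rewrite ler_norml; lra.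
- move=> y; change ((u - planar e pp) y) with (u y - planar e pp y) => pos.
  exists (planar e f y (u y) - planar e f y (planar e pp y)); first exact: parabB.
  rewrite subr_le0; apply: f_high; lra.
Qed.

Lemma pm_le_wave z : planar e pm z <= u z.
Proof.
have g0p := g00; have dp := delta0.
rewrite -subr_le0.
apply: (@interface_maximum_principle R N A q al Ca Cq L (B + B) e eta coefs e1
  eta_lip (planar e pm - u)).
- by move=> y; apply: cvgB; [exact: cpm|exact: cu].
- move=> y; have := bu y; have := bpm y; rewrite !ler_norml.
  change ((planar e pm - u) y) with (planar e pm y - u y); lra.
- move=> eps eps0; have [M M0 hM] := wave eps0; exists M => -[t x] /far_cases /=.
  change ((planar e pm - u) (t, x)) with (planar e pm (t, x) - u (t, x)).
  have [h1 h2] := hM t x; have := gap (t, x); rewrite /planar /=.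
  by move=> g [/h1|/h2]; rewrite ler_norml; lra.
- move=> y; change ((planar e pm - u) y) with (planar e pm y - u y) => pos.
  exists (planar e f y (planar e pm y) - planar e f y (u y)); first exact: parabB.
  rewrite subr_le0; apply: f_low; lra.
Qed.

Definition translate (zeta : 'rV[R]_N) (z : R * 'rV[R]_N) := u (z.1, z.2 + zeta).

Lemma continuous_translate zeta : continuous (translate zeta).
Proof.
apply: (@continuous_composite _ _ _
  (fun w : R * 'rV[R]_N => (w.1, w.2 + zeta)) u _ cu).
apply: continuous_pair; first exact: continuous_time.
by move=> w; apply: cvgD; [exact: continuous_space|exact: cvg_cst].
Qed.

Lemma parab_translate zeta z :
  parab A q (translate zeta) z (f z.1 (dot z.2 e + dot zeta e) (translate zeta z)).
Proof. by rewrite -dotDl; apply: parab_shift; exact: (equ (z.1, z.2 + zeta)). Qed.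

(** Where it is positive, [translate zeta - u] is a subsolution of the linear
    equation: moving ahead decreases [f], and the two values lie in a range in
    which [f] is nonincreasing in the unknown. *)
Lemma translate_le zeta : 0 <= dot zeta e ->
  (forall z, u z < translate zeta z ->
     translate zeta z <= planar e pm z + delta \/ planar e pp z - delta <= u z) ->
  forall z, translate zeta z <= u z.
Proof.
move=> ze0 hz z; rewrite -subr_le0.
apply: (@interface_maximum_principle R N A q al Ca Cq L (B + B) e eta coefs e1
  eta_lip (translate zeta - u)).
- by move=> y; apply: cvgB; [exact: continuous_translate|exact: cu].
- move=> y; have := bu y; have := bu (y.1, y.2 + zeta); rewrite !ler_norml.
  change ((translate zeta - u) y) with (u (y.1, y.2 + zeta) - u y); lra.
- move=> eps eps0; have [M M0 hM] := wave eps0; exists M => -[t x] /far_cases /=.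
  change ((translate zeta - u) (t, x)) with (u (t, x + zeta) - u (t, x)).
  have [h1 _] := hM t x; have [_ h2] := hM t (x + zeta).
  rewrite dotDl in h2.
  have lp := wave_le_pp (t, x + zeta); have lm := pm_le_wave (t, x).
  rewrite /planar /= dotDl in lp lm.
  have := @pp_mono t (dot x e) (dot x e + dot zeta e).
  have := @pm_mono t (dot x e) (dot x e + dot zeta e).
  rewrite lerDl => /(_ ze0) mm /(_ ze0) mp.
  move=> [/h1|far]; first by rewrite ler_norml; lra.
  by have := h2 ltac:(lra); rewrite ler_norml; lra.
- move=> y; change ((translate zeta - u) y) with (translate zeta y - u y) => pos.
  exists (f y.1 (dot y.2 e + dot zeta e) (translate zeta y) - planar e f y (u y)).
    by apply: parabB; [exact: parab_translate|exact: equ].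
  have h1 := @f_mono y.1 (translate zeta y) (dot y.2 e) (dot y.2 e + dot zeta e).
  rewrite lerDl in h1; have {}h1 := h1 ze0.
  have h2 : planar e f y (translate zeta y) <= planar e f y (u y).
    have uw : u y <= translate zeta y by lra.
    have [h|h] := hz y ltac:(lra); [exact: f_low|exact: f_high].
  by rewrite subr_le0; apply: le_trans h2.
Qed.

(** Behind the front [u] is close to [pp]; ahead of it, the translate is close
    to [pm], since the translation goes further ahead. *)
Lemma far_stable : exists2 M : R, 0 <= M & forall zeta z, 0 <= dot zeta e ->
  M <= `|dot z.2 e - eta z.1| ->
  translate zeta z <= planar e pm z + delta \/ planar e pp z - delta <= u z.
Proof.
have [M M0 hM] := wave delta0; exists M => // zeta [t x] ze0 /far_cases[far|far] /=.
  right; have [/(_ far) h _] := hM t x; move: h; rewrite /planar /= ler_norml; lra.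
left; have [_] := hM t (x + zeta); rewrite dotDl => h.
have {h} := h ltac:(rewrite /= in far; lra).
have := @pm_mono t (dot x e) (dot x e + dot zeta e).
rewrite lerDl => /(_ ze0) mm.
rewrite /planar /translate /= ler_norml; lra.
Qed.

(** If the translation is longer than the width of the strip around the front,
    either the point is behind the strip or its translate is ahead of it. *)
Lemma translate_le_start : exists S : R, forall zeta, S <= dot zeta e ->
  forall z, translate zeta z <= u z.
Proof.
have [M M0 hM] := wave delta0; exists (2 * M) => zeta hz.
have ze0 : 0 <= dot zeta e by lra.
apply: translate_le => // -[t x] _.
have [h|h] := leP (dot x e - eta t) (- M).
  right; have [/(_ h) h' _] := hM t x; move: h'; rewrite /planar /= ler_norml; lra.
left; have [_] := hM t (x + zeta); rewrite dotDl => h'.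
have {h'} := h' ltac:(lra).
have := @pm_mono t (dot x e) (dot x e + dot zeta e).
rewrite lerDl => /(_ ze0) mm.
rewrite /planar /translate /= ler_norml; lra.
Qed.

Lemma wave_lipschitz : exists2 k : R, 0 <= k & forall t x y rho, 0 < rho ->
  dot (x - y) (x - y) <= rho ^+ 2 -> u (t, x) - u (t, y) <= k * rho.
Proof.
have B0 : 0 <= B by exact: le_trans (bu (0, 0)).
have F0 : 0 <= F by exact: le_trans (fbound (0, 0) (bu (0, 0))).
have [al0 _ _ _] := coefs.
exists (2 * B + (F + 1) / al); first by rewrite addr_ge0 ?mulr_ge0 ?invr_ge0 ?addr_ge0 ?(ltW al0).
move=> t x y rho; apply: (@lipschitz_space R N A q al Ca Cq B F u coefs cu bu) => z.
by exists (planar e f z (u z)); [exact: equ|exact: fbound].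
Qed.

Lemma difference_supersolution zeta : 0 <= dot zeta e ->
  (forall z, translate zeta z <= u z) -> supersolution A q K (u - translate zeta).
Proof.
move=> ze0 le; split.
- by move=> y; apply: cvgB; [exact: cu|exact: continuous_translate].
- by move=> w; change (0 <= u w - translate zeta w); rewrite subr_ge0.
move=> w; exists (planar e f w (u w) - f w.1 (dot w.2 e + dot zeta e) (translate zeta w)).
  by apply: parabB; [exact: equ|exact: parab_translate].
change ((u - translate zeta) w) with (u w - translate zeta w).
have h1 := @f_mono w.1 (translate zeta w) (dot w.2 e) (dot w.2 e + dot zeta e).
rewrite lerDl in h1; have {}h1 := h1 ze0.
have nn : 0 <= u w - translate zeta w by rewrite subr_ge0.
have := @flip w (u w) (translate zeta w) (bu _) (bu _); rewrite (ger0_norm nn).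
rewrite ler_norml /planar => /andP[h2 _]; lra.
Qed.

Lemma telescoping zeta n t y c :
  (forall j, (j < n)%N -> u (t, y + j%:R *: zeta) - u (t, y + j%:R *: zeta + zeta) < c) ->
  u (t, y) - u (t, y + n%:R *: zeta) <= n%:R * c.
Proof.
elim: n => [|n IH] h; first by rewrite scale0r addr0 subrr mul0r.
have := h n (leqnn _); have {}IH := IH (fun j jn => h j (ltnW jn)).
have -> : y + n.+1%:R *: zeta = y + n%:R *: zeta + zeta.
  by rewrite -natr1 scalerDl scale1r addrA.
rewrite -natr1 mulrDl mul1r; lra.
Qed.

(** Along the arithmetic progression [y + j zeta], which crosses the strip
    around the hyperplane, the wave loses at least half of the gap between
    [pp] and [pm]; so one of the differences [u - translate zeta] is bounded from
    below there, hence on a ball, hence everywhere in the strip one unit of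
    time later. *)
Lemma strip_positivity zeta M : 0 < dot zeta e -> (forall z, translate zeta z <= u z) ->
  exists2 theta : R, 0 < theta & forall t x, `|dot x e - eta t| <= M ->
    theta <= u (t, x) - translate zeta (t, x).
Proof.
have g0p := g00.
move=> ze0 le; have sup := difference_supersolution (ltW ze0) le.
have L0 : 0 <= L.
  have := eta_lip 1 0; rewrite subr0 normr1 mulr1; exact: le_trans.
have [k k0 hk] := wave_lipschitz.
have [M4 M40 hM4] := wave (eps := g0 / 4) ltac:(lra).
(* Shifting by [- b e] from the strip leads, one unit of time earlier, behind the
   front, where [u] is close to [pp]; [n] steps along [zeta] lead from there
   ahead of the front, where [u] is close to [pm]. *)
pose b := `|M| + L + M4.
have b0 : 0 <= b by rewrite /b !addr_ge0.
pose n := (Num.truncn ((2 * M4 + 2 * `|M| + 2 * L + b) / dot zeta e)).+1.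
have n0 : 0 < n%:R :> R by rewrite ltr0n.
have hn : 2 * M4 + 2 * `|M| + 2 * L + b <= n%:R * dot zeta e.
  by rewrite -ler_pdivrMr // ltW // truncnS_gt.
(* The total loss is at least [g0 / 2], hence larger than [n * c]. *)
pose c := g0 / 4 / n%:R; have c0 : 0 < c by rewrite !divr_gt0.
(* Two values of [u] vary by [c / 2] at most, in total, on a ball of radius [rho]. *)
pose rho := c / (4 * (k + 1)).
have k1 : 0 < k + 1 by lra.
have rho0 : 0 < rho by rewrite divr_gt0 // mulr_gt0.
have krho : 2 * (k * rho) <= c / 2.
  have -> : c / 2 = 2 * ((k + 1) * rho) by rewrite /rho; field; lra.
  rewrite ler_pM2l // ler_pM2r //; lra.
have mm := dot_ge0 zeta.
(* As [D >= 1], it is enough that [D] dominates the squared distance. *)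
pose D := 1 + 2 * b ^+ 2 + 2 * n%:R ^+ 2 * dot zeta zeta.
have [th th0 H] := propagation coefs K0 D rho0.
exists (th * (c / 2)); first by rewrite mulr_gt0 // divr_gt0.
move=> t x hM; pose y := x - b *: e.
have [j jn hj] : exists2 j, (j < n)%N &
    c <= u (t - 1, y + j%:R *: zeta) - u (t - 1, y + j%:R *: zeta + zeta).
  apply: contrapT => none.
  have lt j : (j < n)%N ->
      u (t - 1, y + j%:R *: zeta) - u (t - 1, y + j%:R *: zeta + zeta) < c.
    by move=> jn; rewrite ltNge; apply/negP => h; apply: none; exists j.
  have tel := telescoping lt.
  have := eta_lip (t - 1) t; rewrite addrAC subrr sub0r normrN1 mulr1.
  have Mn : M <= `|M| by exact: ler_norm.
  move: hM; rewrite !ler_norml => hM1 hL.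
  have ye : dot y e = dot x e - b by rewrite /y dotDl dotNl dotZl e1 mulr1.
  have [h1 _] := hM4 (t - 1) y; have [_ h2] := hM4 (t - 1) (y + n%:R *: zeta).
  rewrite dotDl dotZl ye in h2; rewrite ye in h1.
  have h1' := h1 ltac:(rewrite /b; lra).
  have h2' := h2 ltac:(lra).
  have gp := gap (t - 1, y); rewrite /planar /= ye in gp.
  have nl : 0 <= n%:R * dot zeta e by rewrite mulr_ge0 // ltW.
  have := @pm_mono (t - 1) (dot x e - b) (dot x e - b + n%:R * dot zeta e).
  rewrite lerDl => /(_ nl) mo.
  have nc : n%:R * c = g0 / 4 by rewrite /c; field; exact: lt0r_neq0.
  rewrite nc in tel.
  move: h1' h2'; rewrite !ler_norml; lra.
apply: (H (u - translate zeta) (c / 2) t x (y + j%:R *: zeta) sup).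
- by rewrite divr_gt0.
- move=> x' hx'; change (c / 2 <= u (t - 1, x') - u (t - 1, x' + zeta)).
  have hx'' : dot (y + j%:R *: zeta - x') (y + j%:R *: zeta - x') <= rho ^+ 2.
    by rewrite -opprB dotNl dotNr opprK.
  have a1 := hk (t - 1) _ _ _ rho0 hx''.
  have a2 := hk (t - 1) (x' + zeta) (y + j%:R *: zeta + zeta) rho rho0.
  rewrite opprD addrACA subrr addr0 in a2; have {}a2 := a2 hx'.
  lra.
- have -> : x - (y + j%:R *: zeta) = b *: e - j%:R *: zeta.
    by rewrite /y !opprD opprK !addrA subrr add0r.
  have jn' : (j%:R : R) ^+ 2 <= n%:R ^+ 2 by rewrite ler_sqr ?nnegrE // ler_nat ltnW.
  have h1 := dot_ge0 (b *: e + j%:R *: zeta).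
  rewrite !(dotDl, dotDr, dotZl, dotZr) e1 in h1.
  have h2 : j%:R ^+ 2 * dot zeta zeta <= n%:R ^+ 2 * dot zeta zeta by rewrite ler_wpM2r.
  have b2 := sqr_ge0 b.
  have nz : 0 <= n%:R ^+ 2 * dot zeta zeta by rewrite mulr_ge0 ?sqr_ge0.
  have D1 : 1 <= D by rewrite /D -[2 * n%:R ^+ 2 * _]mulrA; lra.
  apply: (@le_trans _ _ D); last by rewrite expr2 ler_peMr //; lra.
  rewrite !(dotDl, dotDr, dotNl, dotNr, dotZl, dotZr) e1 /D (dotC zeta e).
  rewrite (dotC zeta e) in h1.
  have -> : 2 * n%:R ^+ 2 * dot zeta zeta = 2 * (n%:R ^+ 2 * dot zeta zeta) by ring.
  lra.
Qed.

(** Once the inequality holds for all large multiples of [zeta], the smallest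
    admissible multiple is 0: otherwise it could be decreased, by strict
    positivity in the strip and by stability outside it. *)
Lemma sliding zeta s : 0 < dot zeta e -> 0 <= s -> forall z, translate (s *: zeta) z <= u z.
Proof.
move=> ze0; pose P s := forall z, translate (s *: zeta) z <= u z.
pose E := [set s | 0 <= s /\ forall r, s <= r -> P r].
have [S hS] := translate_le_start.
have ne : E !=set0.
  exists (`|S| / dot zeta e); split; first by rewrite divr_ge0 // ltW.
  move=> r; rewrite ler_pdivrMr // => h; apply: hS; rewrite dotZl.
  exact: le_trans (ler_norm S) h.
have lb : has_lbound E by exists 0 => r [].
pose ss := inf E.
have above r : ss < r -> P r.
  move=> /(inf_lt ne)[r' [_ hr'] rr']; exact/hr'/ltW.
suff ss0 : ss <= 0.
  rewrite le_eqVlt => /orP[/eqP <- [t x]|s0].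
    by rewrite /translate scale0r addr0.
  by apply: above; exact: le_lt_trans s0.
rewrite leNgt; apply/negP => ss0.
have [k k0 hk] := wave_lipschitz.
pose m := 1 + dot zeta zeta; have m0 : 1 <= m by rewrite lerDl dot_ge0.
have near t x r r' d : 0 < d -> `|r - r'| <= d ->
    u (t, x + r *: zeta) - u (t, x + r' *: zeta) <= k * (d * m).
  move=> d0 hd; apply: hk; first by rewrite mulr_gt0 //; lra.
  have -> : x + r *: zeta - (x + r' *: zeta) = (r - r') *: zeta.
    by rewrite opprD addrACA subrr add0r scalerBl.
  rewrite dotZl dotZr mulrA -expr2 exprMn ler_pM ?sqr_ge0 ?dot_ge0 //.
    by rewrite -real_normK ?num_real // ler_sqr ?nnegrE // ltW.
  by rewrite /m; have := dot_ge0 zeta; nra.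
have km0 : 0 < k * m + 1 by rewrite ltr_wpDl // mulr_ge0 //; lra.
have small ep : 0 < ep -> exists2 d, 0 < d & k * (d * m) <= ep.
  move=> ep0; exists (ep / (k * m + 1)); first by rewrite divr_gt0.
  rewrite mulrCA mulrAC -mulrA ler_piMr ?(ltW ep0) // ler_pdivrMr //; lra.
have Pss : P ss.
  move=> [t x]; apply/ler_addgt0Pr => ep ep0; have [d d0 hd] := small ep ep0.
  have := near t x ss (ss + d) d d0; rewrite opprD addrA subrr sub0r normrN gtr0_norm // lexx.
  move=> /(_ isT); have := above (ss + d) ltac:(lra) (t, x); rewrite /translate /=; lra.
have [M M0 hM] := far_stable.
have [|th th0 hth] := @strip_positivity (ss *: zeta) M _ Pss.
  by rewrite dotZl mulr_gt0.
have [d' d'0 hd'] := small th th0.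
pose d := Num.min d' ss; have d0 : 0 < d by rewrite lt_min d'0.
have dd' : d <= d' by rewrite ge_min lexx.
have dss : d <= ss by rewrite ge_min lexx orbT.
suff : E (ss - d) by move=> /(ge_inf lb); rewrite -/ss; lra.
split; first by rewrite subr_ge0.
move=> r hr; have [h|h] := ltP ss r; first exact: above.
have r0 : 0 <= dot (r *: zeta) e by rewrite dotZl mulr_ge0 ?(ltW ze0) //; lra.
apply: translate_le => // -[t x] lt; apply: hM => //=.
rewrite leNgt; apply/negP => inside.
have := hth t x (ltW inside); have := near t x r ss d' d'0.
have -> : `|r - ss| <= d' by rewrite ler_norml; lra.
move=> /(_ isT); move: lt; rewrite /translate /=; lra.
Qed.

(** A vector orthogonal to [e] is a limit of vectors [zeta + d e] to which
    [sliding] applies. *)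
Lemma monotone_halfspace zeta : 0 <= dot zeta e -> forall z, translate zeta z <= u z.
Proof.
move=> ze0 [t x]; have [k k0 hk] := wave_lipschitz.
apply/ler_addgt0Pr => ep ep0.
pose d := ep / (k + 1); have d0 : 0 < d by rewrite divr_gt0 //; lra.
have kd : k * d <= ep by rewrite mulrCA ler_piMr ?(ltW ep0) // ler_pdivrMr; lra.
have pos : 0 < dot (zeta + d *: e) e by rewrite dotDl dotZl e1 mulr1; lra.
have := sliding pos ler01 (t, x); rewrite scale1r /translate /= addrA.
have := hk t (x + zeta) (x + zeta + d *: e) d d0.
rewrite opprD addrA subrr sub0r dotNl dotNr opprK dotZl dotZr e1 mulr1 -expr2 lexx.
move=> /(_ isT); lra.
Qed.

Lemma wave_planar t x : u (t, x) = u (t, dot x e *: e).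
Proof.
have orth : dot (dot x e *: e - x) e = 0 by rewrite dotDl dotZl dotNl e1 mulr1 subrr.
have orth' : dot (x - dot x e *: e) e = 0 by rewrite dotDl dotNl dotZl e1 mulr1 subrr.
apply/eqP; rewrite eq_le; apply/andP; split.
  have := monotone_halfspace (zeta := x - dot x e *: e) _ (t, dot x e *: e).
  by rewrite orth' lexx /translate /= addrC subrK; apply.
have := monotone_halfspace (zeta := dot x e *: e - x) _ (t, x).
by rewrite orth lexx /translate /= addrC subrK; apply.
Qed.

Lemma wave_decreasing t x y : dot x e < dot y e -> u (t, y) < u (t, x).
Proof.
move=> xy; pose zeta := y - x.
have ze0 : 0 < dot zeta e by rewrite /zeta dotDl dotNl subr_gt0.
have le := monotone_halfspace (ltW ze0).
have [th th0 H] := strip_positivity `|dot x e - eta t| ze0 le.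
have := H t x (lexx _); rewrite /translate /zeta /= [x + _]addrC subrK; lra.
Qed.

Lemma solution_difference_supersolution v w :
  continuous v -> continuous w -> (forall z, `|v z| <= B) -> (forall z, `|w z| <= B) ->
  (forall z, parab A q v z (planar e f z (v z))) ->
  (forall z, parab A q w z (planar e f z (w z))) ->
  (forall z, v z <= w z) -> supersolution A q K (w - v).
Proof.
move=> cv cw bv bw ev ew le; split.
- by move=> y; apply: cvgB; [exact: cw|exact: cv].
- by move=> y; change (0 <= w y - v y); rewrite subr_ge0.
move=> y; exists (planar e f y (w y) - planar e f y (v y)); first exact: parabB.
change ((w - v) y) with (w y - v y).
have nn : 0 <= w y - v y by rewrite subr_ge0.
have := @flip y (w y) (v y) (bw _) (bv _); rewrite (ger0_norm nn) ler_norml; lra.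
Qed.

Lemma wave_lt_pp t x : u (t, x) < pp t (dot x e).
Proof.
have g0p := g00.
have [M M0 hM] := wave (eps := g0 / 4) ltac:(lra).
pose y := x + (M - (dot x e - eta (t - 1))) *: e.
have S := solution_difference_supersolution cu cpp bu bpp equ eqp wave_le_pp.
rewrite -subr_gt0; change (0 < (planar e pp - u) (t, x)).
apply: (positivity_spreads (y := y) coefs K0 x S).
change (0 < planar e pp (t - 1, y) - u (t - 1, y)).
have [_] := hM (t - 1) y; have := gap (t - 1, y); rewrite /planar /=.
have -> : dot y e - eta (t - 1) = M by rewrite /y dotDl dotZl e1; ring.
by move=> g /(_ (lexx _)); rewrite ler_norml; lra.
Qed.

Lemma pm_lt_wave t x : pm t (dot x e) < u (t, x).
Proof.
have g0p := g00.
have [M M0 hM] := wave (eps := g0 / 4) ltac:(lra).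
pose y := x + (- M - (dot x e - eta (t - 1))) *: e.
have S := solution_difference_supersolution cpm cu bpm bu eqm equ pm_le_wave.
rewrite -subr_gt0; change (0 < (u - planar e pm) (t, x)).
apply: (positivity_spreads (y := y) coefs K0 x S).
change (0 < u (t - 1, y) - planar e pm (t - 1, y)).
have [+ _] := hM (t - 1) y; have := gap (t - 1, y); rewrite /planar /=.
have -> : dot y e - eta (t - 1) = - M by rewrite /y dotDl dotZl e1; ring.
by move=> g /(_ (lexx _)); rewrite ler_norml; lra.
Qed.

End Sliding.

(** * From the hypotheses of the theorem to the sliding argument *)

Section Hypotheses.
Context {R : realType} {N : nat}.

Lemma standing_coef_bounds (beta : R) (A : R -> 'M[R]_N) (q : R -> 'rV[R]_N)
    (f : R * 'rV[R]_N -> R -> R) :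
  standing_assumptions beta (fun z => A z.1) (fun z => q z.1) f ->
  exists al Ca Cq, coef_bounds A q al Ca Cq.
Proof.
case=> _ [a1 [a2 [/andP[a10 a12] hA]]] hq _ _.
have [Cf hC] : exists C : 'I_N -> R, forall i t, `|q t 0 i| <= C i.
  have := hq => /choice[C hC]; exists C => i t.
  by have [h _] := hC i; exact: (h (t, 0)).
exists a1, (N%:R * a2), (\sum_i Cf i ^+ 2); split => //.
- by rewrite mulr_ge0 // ltW // (lt_le_trans a10).
- by apply: sumr_ge0 => i _; exact: sqr_ge0.
move=> t; split.
- by move=> v; have /andP[h _] := hA (t, 0) v; rewrite -sqr_enorm.
- rewrite /mxtrace -[N in N%:R]card_ord -sum1_card natr_sum mulr_suml.
  apply: ler_sum => i _; rewrite mul1r.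
  have /andP[_] := hA (t, 0) (delta_mx 0 i); rewrite sqr_enorm /=.
  have -> : dot (delta_mx 0 i) (delta_mx 0 i) = 1 :> R.
    rewrite /dot (bigD1 i) //= big1 => [|j ji]; first by rewrite !mxE !eqxx mulr1 addr0.
    by rewrite !mxE (negbTE ji) mulr0.
  rewrite mulr1 (bigD1 i) //= [X in _ + X]big1 => [|j ji]; last first.
    by rewrite big1 // => l _; rewrite !mxE (negbTE ji) mulr0 mul0r.
  rewrite (bigD1 i) //= big1 => [|j ji]; last by rewrite !mxE (negbTE ji) mulr0.
  by rewrite !mxE !eqxx !mulr1 !addr0.
- apply: ler_sum => i _; rewrite -expr2 -[X in X <= _]real_normK ?num_real //.
  have h := hC i t; rewrite ler_sqr ?nnegrE //; exact: le_trans h.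
Qed.

Lemma solution_parab (A : R -> 'M[R]_N) (q : R -> 'rV[R]_N)
    (f : R * 'rV[R]_N -> R -> R) u z :
  classical_solution (fun z => A z.1) (fun z => q z.1) f u ->
  parab A q u z (f z (u z)).
Proof.
move=> /(solution_jet z) [tau [p [H [J E]]]].
exists tau, p, H; split => //; rewrite E; ring.
Qed.

Lemma solution_continuous (A : R * 'rV[R]_N -> 'M[R]_N) q f (u : R * 'rV[R]_N -> R) :
  classical_solution A q f u -> continuous u.
Proof. by case=> -[]. Qed.

Lemma ereal_inf_gap (T : Type) (g : T -> R) :
  (0 < ereal_inf (range (fun x => (g x)%:E)))%E ->
  exists2 g0 : R, 0 < g0 & forall x, g0 <= g x.
Proof.
have lb x : (ereal_inf (range (fun x => (g x)%:E)) <= (g x)%:E)%E.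
  by apply: ereal_inf_lbound; exists x.
move: lb; case: ereal_inf => [r| |] lb //.
  by rewrite lte_fin => r0; exists r => // x; have := lb x; rewrite lee_fin.
by move=> _; exists 1 => // x; have := lb x; rewrite leye_eq.
Qed.

Lemma ereal_sup_bound (T : Type) (P : set T) (g : T -> R) :
  (ereal_sup [set (g x)%:E | x in P] < +oo)%E ->
  exists C : R, forall x, P x -> g x <= C.
Proof.
have ub x : P x -> ((g x)%:E <= ereal_sup [set (g x)%:E | x in P])%E.
  by move=> Px; apply: ereal_sup_ubound; exists x.
move: ub; case: ereal_sup => [r| |] ub // _.
  by exists r => x /ub; rewrite lee_fin.
by exists 0 => x /ub; rewrite leeNy_eq.
Qed.

End Hypotheses.

Theorem theorem1p15 (R : realType) (N : nat) (hN : (1 <= N)%N)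
  (e : 'rV[R]_N) (he : enorm e = 1)
  (beta : R) (hbeta : 0 < beta)
  (A : R -> 'M[R]_N) (q : R -> 'rV[R]_N) (f : R -> R -> R -> R)
  (hE : standing_assumptions beta
          (fun z => A z.1) (fun z => q z.1) (planar e f))
  (pm pp : R -> R -> R)
  (hpm_bounded : globally_bounded (planar e pm))
  (hpm_solution : classical_solution
          (fun z => A z.1) (fun z => q z.1) (planar e f) (planar e pm))
  (hpp_bounded : globally_bounded (planar e pp))
  (hpp_solution : classical_solution
          (fun z => A z.1) (fun z => q z.1) (planar e f) (planar e pp))
  (hpm_mono : forall t, nonincreasing_fun (pm t))
  (hpp_mono : forall t, nonincreasing_fun (pp t))
  (hf_mono : forall t s, nonincreasing_fun (fun r => f t r s))
  (hf_stable : exists2 delta : R, 0 < delta &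
     forall (t : R) (x : 'rV[R]_N),
       {in `]-oo, pm t (dot x e) + delta] &,
          nonincreasing_fun (f t (dot x e))} /\
       {in `[pp t (dot x e) - delta, +oo[ &,
          nonincreasing_fun (f t (dot x e))})
  (h_gap : (0 < ereal_inf
     (range (fun z : R * 'rV[R]_N =>
               (planar e pp z - planar e pm z)%:E)))%E)
  (xi : R -> R)
  (hxi : exists2 sigma : R, 0 < sigma &
     (ereal_sup [set (`|xi ts.1 - xi ts.2|)%:E | ts in
                   [set ts : R * R | (`|ts.1 - ts.2| <= sigma)%R]] < +oo)%E)
  (u : R * 'rV[R]_N -> R)
  (hu_bounded : globally_bounded u)
  (hu_wave : transition_wave
          (fun z => A z.1) (fun z => q z.1) (planar e f) e xi
          (planar e pm) (planar e pp) u) :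
  [/\ exists phi : R -> R -> R,
        forall (t : R) (x : 'rV[R]_N), u (t, x) = phi t (dot x e),
      forall (t : R) (x : 'rV[R]_N),
        pm t (dot x e) < u (t, x) < pp t (dot x e) &
      forall (t : R) (x y : 'rV[R]_N),
        dot x e < dot y e -> u (t, y) < u (t, x)].
Proof.
have e1 : dot e e = 1 by rewrite -sqr_enorm he expr1n.
have [al [Ca [Cq coefs]]] := standing_coef_bounds hE.
have [Bu hBu] := hu_bounded; have [Bm hBm] := hpm_bounded; have [Bp hBp] := hpp_bounded.
pose B := `|Bu| + `|Bm| + `|Bp|.
have le_B (b : R) : b \in [:: Bu; Bm; Bp] -> b <= B.
  have := (ler_norm Bu, ler_norm Bm, ler_norm Bp).
  have := (normr_ge0 Bu, normr_ge0 Bm, normr_ge0 Bp).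
  by rewrite !inE /B => -[[? ?] ?] -[[? ?] ?] /or3P[] /eqP ->; lra.
have bu z : `|u z| <= B by apply: le_trans (hBu z) (le_B _ _); rewrite !inE eqxx.
have bm z : `|planar e pm z| <= B.
  by apply: le_trans (hBm z) (le_B _ _); rewrite !inE eqxx orbT.
have bp z : `|planar e pp z| <= B.
  by apply: le_trans (hBp z) (le_B _ _); rewrite !inE eqxx !orbT.
have [F hF] := sa_f_C0 hE B; have [K hK] := sa_f_lipschitz hE B.
have [solu _ _ wave] := hu_wave.
have [delta delta0 stable] := hf_stable.
have [g0 g00 gap] := ereal_inf_gap h_gap.
have [sigma sigma0 /ereal_sup_bound[C hC]] := hxi.
have jump t s : `|t - s| <= sigma -> `|xi t - xi s| <= C by exact: (hC (t, s)).
have [eta [L etaL etaC]] := lipschitz_front sigma0 jump.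
have wave' eps : 0 < eps -> exists2 M : R, 0 <= M & forall t x,
    (dot x e - eta t <= - M -> `|u (t, x) - pp t (dot x e)| <= eps) /\
    (dot x e - eta t >= M -> `|u (t, x) - pm t (dot x e)| <= eps).
  move=> /wave[M M0 hM]; have C0 : 0 <= C by exact: le_trans (etaC 0).
  exists (M + C); first exact: addr_ge0.
  move=> t x; have [h1 h2] := hM t x; have := etaC t; rewrite ler_norml => /andP[c1 c2].
  by split=> h; [apply: h1; lra|apply: h2; lra].
have fb z s : `|s| <= B -> `|planar e f z s| <= F by move=> /hF[h _]; exact: h.
have fl z s s' : `|s| <= B -> `|s'| <= B ->
    `|planar e f z s - planar e f z s'| <= `|K| * `|s - s'|.
  move=> hs hs'; apply: le_trans (hK z s s' hs hs') _.
  by rewrite ler_wpM2r // ler_norm.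
have pm_mono t r r' : r <= r' -> pm t r' <= pm t r by exact: hpm_mono.
have pp_mono t r r' : r <= r' -> pp t r' <= pp t r by exact: hpp_mono.
have f_mono t s r r' : r <= r' -> f t r' s <= f t r s by exact: hf_mono.
have low z s s' : s <= s' -> s' <= planar e pm z + delta ->
    planar e f z s' <= planar e f z s.
  move=> ss hs'; have [h _] := stable z.1 z.2.
  by apply: h => //; rewrite in_itv //=; exact: le_trans hs'.
have high z s s' : s <= s' -> planar e pp z - delta <= s ->
    planar e f z s' <= planar e f z s.
  move=> ss hs; have [_ h] := stable z.1 z.2.
  by apply: h => //; rewrite in_itv /= andbT //; exact: le_trans ss.
have gap' z : planar e pm z + g0 <= planar e pp z by have := gap z; lra.
have cu := solution_continuous solu.
have cm := solution_continuous hpm_solution.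
have cp := solution_continuous hpp_solution.
have eu z := solution_parab z solu.
have K0 := normr_ge0 K.
have em z := solution_parab z hpm_solution.
have ep z := solution_parab z hpp_solution.
split.
- exists (fun t r => u (t, r *: e)).
  exact: (wave_planar coefs e1 K0 g00 delta0 etaL bu bm bp cu cm cp fb fl eu em ep
    pm_mono pp_mono f_mono low high gap' wave').
- move=> t x; apply/andP; split.
    exact: (pm_lt_wave coefs e1 K0 g00 delta0 etaL bu bm cu cm fl eu em low gap' wave').
  exact: (wave_lt_pp coefs e1 K0 g00 delta0 etaL bu bp cu cp fl eu ep high gap' wave').
- exact: (wave_decreasing coefs e1 K0 g00 delta0 etaL bu bm bp cu cm cp fb fl eu em ep
    pm_mono pp_mono f_mono low high gap' wave').
Qed.
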